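(* Let $G$ be a Carnot group of homogeneous dimension $Q$. Let $1<r,s<\infty$, $0<\lambda<Q$ and let $\alpha,\beta$ be real numbers with $\alpha+\beta\ge 0$ such that $\lambda+\alpha+\beta\le Q$, $\alpha<Q/r'$, $\beta<Q/s'$ and $$\frac1r+\frac1s+\frac{\lambda+\alpha+\beta}{Q}=2 .$$ Then there exists a positive constant $C_{\alpha,\beta,r,\lambda,G}$ such that for all $f\in L^r(G)$ and $g\in L^s(G)$, $$\left|\iint_{G\times G}\frac{\overline{f(u)}\,g(v)}{|u|^{\alpha}\,|u^{-1}v|^{\lambda}\,|v|^{\beta}}\,du\,dv\right|\le C_{\alpha,\beta,r,\lambda,G}\,\|f\|_r\,\|g\|_s ,$$ the constant being independent of $f$ and $g$.
   Context: A Carnot group $G$ of step $k$ is a simply connected nilpotent Lie group whose Lie algebra $\mathfrak g$ admits a stratification $\mathfrak g=V_1\oplus\cdots\oplus V_k$ with $[V_1,V_l]=V_{l+1}$ for $1\le l\le k-1$ and $[V_1,V_k]=\{0\}$. Put $m_l=\dim V_l$. Coordinates $u=(z_1,\dots,z_k)$, $z_l\in\mathbb R^{m_l}$, are fixed on $G$ (exponential coordinates adapted to the stratification, in which the group law is given by the Baker-Campbell-Hausdorff formula). The dilations are $\delta_t(u)=(tz_1,t^2z_2,\dots,t^kz_k)$, $t>0$, and the homogeneous dimension is $Q=\sum_{l=1}^k l\,m_l$. $du$ denotes a fixed Haar measure on $G$. The homogeneous norm is $|u|=\left(\sum_{j=1}^k|z_j|^{2k!/j}\right)^{1/(2k!)}$,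 where $|z_j|$ is the Euclidean norm in $\mathbb R^{m_j}$ and $2k!$ means $2\cdot(k!)$. Functions are complex-valued; $\|\cdot\|_p$ is the norm of $L^p(G)=L^p(G,du)$. $r'$ and $s'$ denote the conjugate exponents of $r$ and $s$ (e.g. $1/r+1/r'=1$). *)

(* Defs.v *)
From HB Require Import structures.
From mathcomp Require Import all_boot all_order all_algebra.
From mathcomp Require Import all_classical all_reals all_analysis.
From mathcomp Require Import complex.

Set Implicit Arguments.
Unset Strict Implicit.
Unset Printing Implicit Defensive.

Import Order.TTheory GRing.Theory Num.Theory.
Import numFieldNormedType.Exports.

Local Open Scope classical_set_scope.
Local Open Scope ring_scope.

Section StratifiedAlgebra.
Context {R : realType} (k : nat) (m : 'I_k -> nat).
Local Notation V := 'rV[R]_(\sum_(j < k) m j).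

(* A vector u = (z_1, ..., z_k) has z_{j+1} = [submxrow u j] for j : 'I_k; layers
   are numbered from 1, and [layer l] is {0} for l = 0 and for l > k. *)
Definition layer (l : nat) : {vspace V} :=
  span [seq delta_mx 0 i | i <- enum 'I_(\sum_(j < k) m j)
                         & (tagnat.sig1 i).+1 == l].

(* The span of the brackets [x, y] with x in U and y in W, for a bilinear b. *)
Definition bracketv (b : V -> V -> V) (U W : {vspace V}) : {vspace V} :=
  span [seq b x y | x <- vbasis U, y <- vbasis W].

End StratifiedAlgebra.

(* A Carnot group in exponential coordinates of the first kind adapted to the
   stratification: the group is its Lie algebra, with underlying space
   R^(m_1 + ... + m_k), and the group law [cmul] is the Baker-Campbell-Hausdorff
   product. *)
Record carnotGroup (R : realType) := CarnotGroup {
  step : nat ;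
  ldim : 'I_step -> nat ;
  bracket : 'rV[R]_(\sum_(j < step) ldim j) ->
            'rV[R]_(\sum_(j < step) ldim j) ->
            'rV[R]_(\sum_(j < step) ldim j) ;
  bracket_linearl : forall y, linear (bracket^~ y) ;
  bracket_linearr : forall x, linear (bracket x) ;
  bracketxx : forall x, bracket x x = 0 ;
  bracket_jacobi : forall x y z,
    bracket x (bracket y z) + bracket y (bracket z x) +
    bracket z (bracket x y) = 0 ;
  bracket_layer : forall l, (1 <= l < step)%N ->
    bracketv bracket (layer ldim 1) (layer ldim l) = layer ldim l.+1 ;
  bracket_last : bracketv bracket (layer ldim 1) (layer ldim step) = 0%VS }.

Arguments step {R}.
Arguments ldim {R}.
Arguments bracket {R}.

Definition copen (R : realType) (G : carnotGroup R) :
  set (set 'rV[R]_(\sum_(j < step G) ldim G j)) := open.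
Arguments copen {R}.

(* The underlying space of G with its Borel sigma-algebra. *)
Notation carnot G := (g_sigma_algebraType (copen G)).

Section Group.
Context {R : realType} (G : carnotGroup R).
Local Notation V := 'rV[R]_(\sum_(j < step G) ldim G j).

(* [x1, [x2, ..., [x_(p-1), x_p]]] *)
Fixpoint nested_bracket (w : seq V) : V :=
  match w with
  | [::] => 0
  | [:: x] => x
  | x :: w' => bracket G x (nested_bracket w')
  end.

(* The word x^(r_1) y^(s_1) ... x^(r_n) y^(s_n), with rs i = (r_(i+1), s_(i+1)). *)
Definition dynkin_word (n K : nat) (rs : {ffun 'I_n -> 'I_K * 'I_K})
    (x y : V) : seq V :=
  flatten [seq nseq (rs i).1 x ++ nseq (rs i).2 y | i <- enum 'I_n].

(* Dynkin's form of log (exp x * exp y):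
     sum_(n >= 1) (-1)^(n-1) / n * sum_(r_i + s_i > 0)
       [x^(r_1) y^(s_1) ... x^(r_n) y^(s_n)]
         / ((sum_i (r_i + s_i)) * prod_i (r_i! s_i!)).
   Brackets of more than [step G] elements vanish, so n and the exponents r_i, s_i
   only need to run up to [step G]; the n of the formula is n.+1 below. *)
Definition cmul (x y : V) : V :=
  \sum_(n < step G) ((-1) ^+ n / n.+1%:R) *:
    \sum_(rs : {ffun 'I_n.+1 -> 'I_(step G).+1 * 'I_(step G).+1} |
            [forall i, 0 < (rs i).1 + (rs i).2]%N)
      (((\sum_i ((rs i).1 + (rs i).2)) *
        \prod_i (((rs i).1)`! * ((rs i).2)`!))%N%:R)^-1 *:
      nested_bracket (dynkin_word rs x y).

(* exp (x)^-1 = exp (- x). *)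
Definition cinv (x : V) : V := - x.

Definition hdim : nat := (\sum_(j < step G) j.+1 * ldim G j)%N.

Definition enorm (n : nat) (z : 'rV[R]_n) : R :=
  Num.sqrt (\sum_i z 0 i ^+ 2).

Definition hnorm (u : V) : R :=
  (\sum_(j < step G) enorm (submxrow u j) `^ ((2 * (step G)`!)%:R / j.+1%:R))
    `^ ((2 * (step G)`!)%:R)^-1.

(* A left Haar measure: a nonzero left-invariant Borel measure, finite on compact
   sets. Regularity is automatic on R^n. *)
Definition is_haar (mu : set (carnot G) -> \bar R) : Prop :=
  [/\ forall (x : V) (A : set (carnot G)), measurable A ->
        mu [set cmul x y | y in A] = mu A,
      forall A : set V, compact A -> (mu A < +oo)%E
    & mu [set: carnot G] != 0%E].

End Group.

Arguments cmul {R} G.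
Arguments cinv {R} G.
Arguments hnorm {R} G.
Arguments is_haar {R} G.

Section ComplexIntegration.
Context {d : measure_display} {T : measurableType d} {R : realType}.

Definition cLnorm (mu : {measure set T -> \bar R}) (p : R) (f : T -> R[i]) : \bar R :=
  Lnorm mu p%:E (fun x => (Normc.normc (f x))%:E).

Definition cmeasurable (f : T -> R[i]) : Prop :=
  measurable_fun [set: T] (fun x => complex.Re (f x)) /\
  measurable_fun [set: T] (fun x => complex.Im (f x)).

Definition cLp (mu : {measure set T -> \bar R}) (p : R) (f : T -> R[i]) : Prop :=
  cmeasurable f /\ (cLnorm mu p f < +oo)%E.

Definition cintegrable (mu : {measure set T -> \bar R}) (f : T -> R[i]) : Prop :=
  mu.-integrable [set: T] (fun x => (complex.Re (f x))%:E) /\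
  mu.-integrable [set: T] (fun x => (complex.Im (f x))%:E).

Definition cintegral (mu : {measure set T -> \bar R}) (f : T -> R[i]) : R[i] :=
  Complex (Rintegral mu [set: T] (fun x => complex.Re (f x)))
          (Rintegral mu [set: T] (fun x => complex.Im (f x))).

End ComplexIntegration.

Definition stein_weiss_integrand (R : realType) (G : carnotGroup R)
    (alpha beta lambda : R) (f g : carnot G -> R[i])
    (uv : carnot G * carnot G) : R[i] :=
  (conjc (f uv.1) * g uv.2) /
  real_complex R (hnorm G uv.1 `^ alpha * hnorm G (cmul G (cinv G uv.1) uv.2) `^ lambda *
     hnorm G uv.2 `^ beta).
Arguments stein_weiss_integrand {R} G.

(* Main.v *)
(* Write N u = |u|, D (u, v) = |u^-1 v| and Q for the homogeneous dimension.

   Applying log (g^-1) = - log g to truncated exponentials of strictly upper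
   triangular matrices and reading off the coefficient of each word turns it into
   an identity for the Dynkin series, so (-y)(-x) = -(xy) and D is symmetric;
   associativity of the group law is never needed. The layer l of xy is
   x_l + y_l plus a polynomial in the layers below l, so equations xy = z are
   solved one layer at a time. Hence N and D satisfy quasi-triangle inequalities,
   and the translates of a box by a dilated lattice tile the group: counting tiles
   bounds the Haar measure of a ball of radius t by a multiple of t^Q.

   For the inequality put a = |f|^r and b = |g|^s, both of integral at most 1. By
   convexity of the exponential the integrand is bounded pointwise by a multiple
   of a(u) K(u, v) + b(v) L(u, v) + a(u) b(v), where K and L are powers of N or D
   truncated at a radius that depends only on u, respectively only on v, and
   scaled so that by the volume bound their integrals in the other variable are
   bounded. When N u and N v are not comparable, D is comparable to the larger of
   the two and the cut-off is at the smaller (Hardy type); when they are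
   comparable and alpha + beta > 0, D is cut off at a multiple of N; when alpha +
   beta = 0, at a^(-1/Q) and b^(-1/Q) respectively (Hardy-Littlewood-Sobolev). *)

From HB Require Import structures.
Require Import Defs.
From mathcomp Require Import all_boot all_order all_algebra.
From mathcomp Require Import all_classical all_reals all_analysis.
From mathcomp Require Import complex measurable_realfun.
From mathcomp Require Import zify ring lra.

Set Implicit Arguments.
Unset Strict Implicit.
Unset Printing Implicit Defensive.

Import Order.TTheory GRing.Theory Num.Theory.
Import numFieldNormedType.Exports.

Local Open Scope classical_set_scope.
Local Open Scope ring_scope.

(** * Truncated exponential and logarithm *)

Section TruncatedLog.
Context {F : numFieldType}.
Implicit Types (p q : {poly F}) (k : nat).

(** The group law is given only as a truncated series, and [is_haar] grants only left invariance.
    Left translation bounds the measure of {v : D(u, v) <= t}; the same bound in u rests on the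
    symmetry of D, which is why log (g^-1) = - log g is established for the Dynkin series. In the
    pointwise bound, with p1 = 1/r and p2 = 1/s, the three terms must carry the weights 1 - p2, 1 -
    p1 and p1 + p2 - 1 for a and b to receive the exponents p1 and p2. The last weight is
    nonnegative exactly when lambda + alpha + beta <= Q. The conditions alpha < Q/r' and beta < Q/s'
    put the exponents of the Hardy kernels on the convergent sides of Q. For alpha + beta > 0 the
    kernel in D has an exponent below Q. For alpha + beta = 0 that exponent would be Q, where the
    integral diverges logarithmically at 0; hence the different cut-off, by the size of a or b. *)

Lemma dvdXnP k p : reflect (forall i, (i < k)%N -> p`_i = 0) ('X^k %| p).
Proof.
apply: (iffP idP) => [/dvdpP[q ->] i ik|p0]; first by rewrite coefMXn ik.
rewrite -(poly_take_drop k p) (_ : take_poly k p = 0) ?add0r ?dvdp_mull//.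
by apply/polyP => i; rewrite coef_take_poly coef0; case: ifP => // /p0.
Qed.

Lemma dvdXn_deriv k p : 'X^k %| p^`() -> p`_0 = 0 -> 'X^(k.+1) %| p.
Proof.
move=> /dvdXnP dp p0; apply/dvdXnP => -[//|i] ik.
have := dp i ik; rewrite coef_deriv => /eqP.
by rewrite mulrn_eq0 => /eqP.
Qed.

Lemma exprNX n : (- 'X : {poly F}) ^+ n = (-1) ^+ n *: 'X^n.
Proof. by rewrite -scaleN1r exprZn. Qed.

Definition pexp k : {poly F} := \poly_(i < k.+1) (i`!%:R)^-1.
Definition plog k : {poly F} :=
  \sum_(n < k) ((-1) ^+ n / n.+1%:R) *: 'X^(n.+1).
Definition pinv k : {poly F} := \sum_(n < k) (-1) ^+ n.+1 *: 'X^(n.+1).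

Lemma deriv_pexp k : (pexp k)^`() = pexp k - (k`!%:R)^-1 *: 'X^k.
Proof.
apply/polyP => i; rewrite coef_deriv coefB coefZ coefXn !coef_poly !ltnS.
case: ltngtP => [ik|ik|->].
- rewrite mulr0 subr0 factS natrM invfM -[LHS]mulr_natr mulrAC mulVf ?mul1r//.
- by rewrite mul0rn mulr0 subr0.
- by rewrite mul0rn mulr1 subrr.
Qed.

(** Differentiating [pexp k] only loses its top term, so the derivative of the product is a multiple
    of X^k, and the product is 1 at 0. *)
Lemma pexpN k : 'X^(k.+1) %| pexp k * (pexp k \Po (- 'X)) - 1.
Proof.
apply: dvdXn_deriv.
  rewrite derivB derivM deriv_comp derivN derivX deriv_pexp -polyC1 derivC subr0.
  rewrite comp_polyB comp_polyZ comp_Xn_poly mulrN1.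
  set A := pexp k; set B := A \Po _; set c := (_)^-1.
  have -> : (A - c *: 'X^k) * B + A * - (B - c *: (- 'X) ^+ k) =
    'X^k * (A * (c *: (-1) ^+ k) - c *: B).
    rewrite [(- 'X) ^+ k]exprNn -!mul_polyC; ring.
  exact: dvdp_mulr.
rewrite coefB -!horner_coef0 hornerM horner_comp hornerN hornerX oppr0.
rewrite !horner_coef0 coef_poly/= fact0 invr1 mulr1.
by rewrite coefC subrr.
Qed.

Lemma deriv_plog k : (1 + 'X) * (plog k)^`() = 1 - (- 'X) ^+ k.
Proof.
have -> : (plog k)^`() = \sum_(n < k) (- 'X) ^+ n.
  rewrite raddf_sum /=; apply: eq_bigr => n _.
  by rewrite derivZ derivXn /= exprNX -[X in _ *: X]scaler_nat scalerA mulfVK ?pnatr_eq0.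
by rewrite -[in RHS](expr1n _ k) subrXX opprK; congr (_ * _);
  apply: eq_bigr => i _; rewrite expr1n mul1r.
Qed.

Lemma pinvE k : (1 + 'X) * (1 + pinv k) = 1 - (- 'X) ^+ k.+1.
Proof.
have -> : 1 + pinv k = \sum_(n < k.+1) (- 'X) ^+ n.
  rewrite big_ord_recl expr0; congr (_ + _); apply: eq_bigr => n _.
  by rewrite [in RHS]exprNX.
by rewrite -[in RHS](expr1n _ k.+1) subrXX opprK; congr (_ * _);
  apply: eq_bigr => i _; rewrite expr1n mul1r.
Qed.

Lemma dvdX_pinv k : 'X %| pinv k.
Proof.
rewrite /pinv; apply: (big_ind (fun p => 'X %| p)) => [|p q|i _]; first exact: dvdp0.
  exact: dvdp_add.
by rewrite -mul_polyC dvdp_mull// exprS dvdp_mulr.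
Qed.

(** This is log (1 + X) + log ((1 + X)^-1) = 0 up to order k. The constant term vanishes, and the
    derivative may be tested for divisibility by X^k after multiplication by 1 + X, which is coprime
    to X^k. *)
Lemma plog_inv k : 'X^(k.+1) %| plog k + (plog k \Po pinv k).
Proof.
set L := plog k; set q := pinv k.
apply: dvdXn_deriv; last first.
  have q0 : q`_0 = 0.
    by have /dvdpP[r e] := dvdX_pinv k; rewrite /q e coefMX.
  have L0 : L`_0 = 0.
    by rewrite coef_sum big1// => i _; rewrite coefZ coefXn mulr0.
  by rewrite coefD L0 -horner_coef0 horner_comp horner_coef0 q0 horner_coef0 L0 addr0.
rewrite derivD deriv_comp.
have cop : coprimep 'X^k (1 + 'X : {poly F}).
  apply: coprimep_expl; rewrite coprimep_sym coprimepX /root hornerD hornerX.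
  by rewrite -polyC1 hornerC addr0 oner_eq0.
rewrite -(Gauss_dvdpr _ cop) mulrDr deriv_plog.
have dq : (1 + 'X) * q^`() = - (1 + q) - (- 1) ^+ k.+1 *: ('X^k *+ k.+1).
  have /(congr1 (fun p : {poly F} => p^`())) := pinvE k.
  rewrite exprNX derivM !derivD -/q -polyC1 derivN derivZ !derivC derivX.
  by rewrite derivXn !add0r mul1r polyC1 => <-; ring.
rewrite mulrCA dq.
have := congr1 (fun p => p \Po q) (deriv_plog k).
rewrite /= comp_polyM comp_polyB comp_polyD comp_polyX -polyC1 comp_polyC.
rewrite (rmorphXn (comp_poly q)) /= raddfN /= comp_polyX => hq.
rewrite mulrBr mulrN [_ * (1%:P + q)]mulrC hq.
have /dvdpP[r] := dvdX_pinv k; rewrite -/q => qE.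
set E := _ \Po q.
rewrite exprNX [(- q) ^+ k]exprNn qE exprMn polyC1 -!mul_polyC -mulr_natr.
set c := (_ ^+ k)%:P; set c' := (_ ^+ k.+1)%:P.
have -> : 1 - c * 'X^k + (- (1 - (-1) ^+ k * (r ^+ k * 'X^k)) -
   E * (c' * ('X^k * k.+1%:R))) =
   'X^k * (- c + (-1) ^+ k * r ^+ k - E * c' * k.+1%:R) by ring.
exact: dvdp_mulr.
Qed.

End TruncatedLog.

(** * Exponential and logarithm of strictly upper triangular matrices *)

Section StrictlyUpper.
Context {F : numFieldType} {p : nat}.
Implicit Types (A B : 'M[F]_p.+1).

(* The first d diagonals of A, counted from the main one, and everything below
   them vanish. *)
Definition supper (d : nat) A := forall i j : 'I_p.+1, (j < i + d)%N -> A i j = 0.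

Lemma supper_mul a b A B : supper a A -> supper b B -> supper (a + b) (A * B).
Proof.
move=> hA hB i j ij; rewrite mxE big1// => l _.
have [il|il] := ltnP l (i + a); first by rewrite hA ?mul0r.
by rewrite hB ?mulr0// (leq_trans ij)// addnA leq_add2r.
Qed.

Lemma supper_exp A d : supper 1 A -> supper d (A ^+ d).
Proof.
move=> hA; elim: d => [|d IH]; last by rewrite exprS -add1n; exact: supper_mul.
move=> i j; rewrite addn0 => ij; rewrite mxE.
by case: eqP ij => // ->; rewrite ltnn.
Qed.

Lemma supper_le a b A : (b <= a)%N -> supper a A -> supper b A.
Proof. by move=> ba hA i j ij; apply: hA; rewrite (leq_trans ij)// leq_add2l. Qed.

Lemma supper_eq0 A d : (p < d)%N -> supper d A -> A = 0.
Proof.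
move=> pd hA; apply/matrixP => i j; rewrite hA ?mxE//.
by rewrite (leq_trans (ltn_ord j))// (leq_trans pd)// leq_addl.
Qed.

Lemma supperD d A B : supper d A -> supper d B -> supper d (A + B).
Proof. by move=> hA hB i j ij; rewrite mxE hA// hB// addr0. Qed.

Lemma supperN d A : supper d A -> supper d (- A).
Proof. by move=> hA i j ij; rewrite mxE hA// oppr0. Qed.

Lemma supperZ d c A : supper d A -> supper d (c *: A).
Proof. by move=> hA i j ij; rewrite mxE hA// mulr0. Qed.

Lemma horner_mxE A (q : {poly F}) :
  horner_mx A q = \sum_(i < size q) q`_i *: A ^+ i.
Proof.
rewrite -{1}[q]coefK poly_def raddf_sum /=; apply: eq_bigr => i _.
by rewrite linearZ /= rmorphXn /= horner_mx_X.
Qed.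

Lemma horner_mx_comp A (q r : {poly F}) :
  horner_mx A (q \Po r) = horner_mx (horner_mx A r) q.
Proof.
rewrite comp_polyE raddf_sum /= horner_mxE; apply: eq_bigr => i _.
by rewrite linearZ /= rmorphXn.
Qed.

(** A strictly upper triangular matrix of size p + 1 satisfies A^(p + 1) = 0, so polynomial
    congruences modulo X^(k + 1) become matrix identities. *)
Lemma horner_mx_supper k A (q : {poly F}) : (p <= k)%N -> supper 1 A ->
  'X^(k.+1) %| q -> horner_mx A q = 0.
Proof.
move=> pk hA /dvdpP[r ->]; rewrite rmorphM rmorphXn /= horner_mx_X.
by rewrite (supper_eq0 (pk : (p < k.+1)%N) (supper_exp hA)) mulr0.
Qed.

Definition mexp k A := horner_mx A (pexp k).

Lemma mexpE k A : mexp k A = \sum_(i < k.+1) (i`!%:R)^-1 *: A ^+ i.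
Proof.
rewrite /mexp /pexp poly_def raddf_sum /=; apply: eq_bigr => i _.
by rewrite linearZ /= rmorphXn /= horner_mx_X.
Qed.

Lemma mexpN k A : (p <= k)%N -> supper 1 A -> mexp k A * mexp k (- A) = 1.
Proof.
move=> pk hA; have := horner_mx_supper pk hA (pexpN k).
rewrite (rmorphB (horner_mx A)) (rmorphM (horner_mx A)) (rmorph1 (horner_mx A)).
  rewrite /= horner_mx_comp raddfN /= horner_mx_X => /eqP.
by rewrite subr_eq0 => /eqP.
Qed.

Lemma mexp_supper k A : supper 1 A -> supper 1 (mexp k A - 1).
Proof.
move=> hA; rewrite mexpE big_ord_recl fact0 invr1 scale1r expr0 addrC addKr.
apply: big_ind => [|B C|i _]; first by move=> i j _; rewrite mxE.
  exact: supperD.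
by apply: supperZ; exact: supper_le (supper_exp hA).
Qed.

(** log (exp A * exp B), with both series cut at k. *)
Definition elog k A B : 'M[F]_p.+1 :=
  \sum_(n < k) ((-1) ^+ n / n.+1%:R) *: (mexp k A * mexp k B - 1) ^+ n.+1.

Lemma elogE k A B : elog k A B = horner_mx (mexp k A * mexp k B - 1) (plog k).
Proof.
rewrite raddf_sum /=; apply: eq_bigr => i _.
by rewrite linearZ /= rmorphXn /= horner_mx_X.
Qed.

Lemma mexpM_supper k A B : supper 1 A -> supper 1 B ->
  supper 1 (mexp k A * mexp k B - 1).
Proof.
move=> hA hB.
have -> : mexp k A * mexp k B - 1 =
  (mexp k A - 1) * (mexp k B - 1) + (mexp k A - 1) + (mexp k B - 1).
  by rewrite mulrBr mulr1 subrK mulrBl mul1r addrA subrK.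
apply: supperD; last exact: mexp_supper.
apply: supperD; last exact: mexp_supper.
by apply: (@supper_le 2); last exact: (@supper_mul 1 1 _ _ (mexp_supper _ _) (mexp_supper _ _)).
Qed.

(* log (g^-1) = - log g, with g = exp A * exp B *)
Lemma elog_inv k A B : (p <= k)%N -> supper 1 A -> supper 1 B ->
  elog k (- B) (- A) = - elog k A B.
Proof.
move=> pk hA hB; rewrite !elogE.
set T := mexp k A * _ - 1; set T' := mexp k (- B) * _ - 1.
have hT : supper 1 T by exact: mexpM_supper.
have T1 : (1 + T') * (1 + T) = 1.
  rewrite /T /T' ![1 + _]addrC !subrK -mulrA [mexp k (- A) * _]mulrA.
  have := @mexpN k (- A) pk (supperN hA); rewrite opprK => ->; rewrite mul1r.
  by have := @mexpN k (- B) pk (supperN hB); rewrite opprK.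
have T2 : (1 + T) * (1 + horner_mx T (pinv k)) = 1.
  have := congr1 (horner_mx T) (pinvE k).
  rewrite (rmorphM (horner_mx T)) !(rmorphD (horner_mx T)) (rmorph1 (horner_mx T)).
  rewrite !(rmorphN (horner_mx T)) (rmorphXn (horner_mx T)) /=.
  rewrite (rmorphN (horner_mx T)) /= !horner_mx_X => ->.
  by rewrite (supper_eq0 (pk : (p < k.+1)%N) (supper_exp (supperN hT))) subr0.
(* The left inverse 1 + T' of 1 + T and the right inverse given by the truncated geometric series
   coincide. *)
have T'E : T' = horner_mx T (pinv k).
  have := congr1 ( *%R (1 + T')) T2.
  by rewrite mulrA T1 mul1r mulr1 => /addrI.
have := horner_mx_supper pk hT (plog_inv k).
rewrite raddfD /= horner_mx_comp -T'E => /eqP; rewrite addrC addr_eq0.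
by move/eqP.
Qed.

End StrictlyUpper.

(** * The Dynkin series *)

(* Unlike big_enum, this does not need a commutative operation. *)
Lemma big_enum_fin (R : Type) (idx : R) (op : R -> R -> R) (I : finType) (f : I -> R) :
  \big[op/idx]_(i <- enum I) f i = \big[op/idx]_i f i.
Proof. by rewrite enumT [index_enum _]unlock. Qed.

Section Words.
Context {F : numFieldType}.

Definition bword (n K : nat) (rs : {ffun 'I_n -> 'I_K * 'I_K}) : seq bool :=
  flatten [seq nseq (rs i).1 false ++ nseq (rs i).2 true | i <- enum 'I_n].

Lemma size_bword n K (rs : {ffun 'I_n -> 'I_K * 'I_K}) :
  size (bword rs) = (\sum_i ((rs i).1 + (rs i).2))%N.
Proof.
rewrite size_flatten /shape -map_comp sumnE big_map big_enum_fin.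
apply: eq_bigr => i _ /=.
by rewrite size_cat !size_nseq.
Qed.

(* The Dynkin series with the bracket of each word u replaced by
   size u *: phi u. *)
Definition dsum (k : nat) (U : lmodType F) (phi : seq bool -> U) : U :=
  \sum_(n < k) ((-1) ^+ n / n.+1%:R) *:
    \sum_(rs : {ffun 'I_n.+1 -> 'I_k.+1 * 'I_k.+1} |
            [forall i, 0 < (rs i).1 + (rs i).2]%N)
      ((\prod_i (((rs i).1)`! * ((rs i).2)`!))%N%:R)^-1 *: phi (bword rs).

Lemma eq_dsum k (U : lmodType F) (phi psi : seq bool -> U) :
  phi =1 psi -> dsum k phi = dsum k psi.
Proof.
move=> e; apply: eq_bigr => n _; congr (_ *: _); apply: eq_bigr => rs _.
by rewrite e.
Qed.

Lemma linear_dsum k (U W : lmodType F) (f : {linear U -> W})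
  (phi : seq bool -> U) : f (dsum k phi) = dsum k (fun u => f (phi u)).
Proof.
rewrite /dsum raddf_sum /=; apply: eq_bigr => n _; rewrite linearZ /=.
congr (_ *: _); rewrite raddf_sum /=; apply: eq_bigr => rs _.
by rewrite linearZ.
Qed.

Lemma dsum_sum k (U : lmodType F) (I : finType) (phi : I -> seq bool -> U) :
  dsum k (fun u => \sum_i phi i u) = \sum_i dsum k (phi i).
Proof.
rewrite /dsum exchange_big /=; apply: eq_bigr => n _; rewrite -scaler_sumr.
congr (_ *: _); rewrite exchange_big /=; apply: eq_bigr => rs _.
by rewrite scaler_sumr.
Qed.

Lemma dsum_scale k (U : lmodType F) (c : seq bool -> F^o) (v : U) :
  dsum k (fun u => c u *: v) = (dsum k c : F) *: v.
Proof.
rewrite /dsum scaler_suml; apply: eq_bigr => n _.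
rewrite -[RHS]scalerA; congr (_ *: _); rewrite scaler_suml; apply: eq_bigr => rs _.
by rewrite scalerA.
Qed.

Definition wprod p (A B : 'M[F]_p.+1) (u : seq bool) : 'M[F]_p.+1 :=
  \prod_(c <- u) (if c then B else A).

Lemma wprod_bword p (A B : 'M[F]_p.+1) n K (rs : {ffun 'I_n -> 'I_K * 'I_K}) :
  wprod A B (bword rs) = \prod_i (A ^+ (rs i).1 * B ^+ (rs i).2).
Proof.
rewrite /wprod /bword big_flatten big_map big_enum_fin.
apply: eq_bigr => i _ /=.
by rewrite big_cat !big_nseq !iter_mulr_1.
Qed.

(** exp A * exp B - 1 is the sum of A^r B^s / (r! s!) over (r, s) other than (0, 0). Distributing
    its powers over the factors, in their order, produces one term for each choice of exponents,
    which is the index set of the Dynkin series. *)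
Lemma elog_dsum p k (A B : 'M[F]_p.+1) : elog k A B = dsum k (wprod A B).
Proof.
apply: eq_bigr => n _; congr (_ *: _).
pose ed (i : 'I_k.+1 * 'I_k.+1) : F := (i.1`! * i.2`!)%N%:R^-1.
have -> : mexp k A * mexp k B - 1 = \sum_(i : 'I_k.+1 * 'I_k.+1 |
    (0 < i.1 + i.2)%N) ed i *: (A ^+ i.1 * B ^+ i.2).
  rewrite !mexpE mulr_suml.
  under eq_bigr do rewrite mulr_sumr.
  rewrite pair_big /= (bigD1 (ord0, ord0)) //= !expr0 fact0 invr1 !scale1r mulr1.
  rewrite [LHS]addrC addKr; apply: eq_big => [[i j]|[i j] _] /=.
    by rewrite xpair_eqE -!val_eqE /= addn_gt0 !lt0n negb_and.
  by rewrite -scalerAl -scalerAr scalerA /ed natrM invfM.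
set S := (X in X ^+ _).
have -> : S ^+ n.+1 = \prod_(i < n.+1) S by rewrite prodr_const card_ord.
rewrite bigA_distr_big; apply: eq_big => [rs|rs _].
  by apply/ffun_onP/forallP.
by rewrite scaler_prod wprod_bword /ed natr_prod prodfV.
Qed.

(** Edge matrices of the path 0, 1, ..., size w whose edge from i to i + 1 carries the i-th letter
    of w. A product of them along a word u has entry 1 at (i, j) exactly when u labels the path from
    i to j, so the corner entry (0, size w) detects u = w. *)
Definition letter_mx (w : seq bool) (b : bool) : 'M[F]_((size w).+1) :=
  \matrix_(i, j) ((j == i.+1 :> nat) && (nth false w i == b))%:R.

Lemma letter_mx_supper w b : supper 1 (letter_mx w b).
Proof.
by move=> i j; rewrite addn1 ltnS mxE => ji; case: eqP ji => // ->; rewrite ltnn.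
Qed.

Lemma wprod_letter w u (i j : 'I_((size w).+1)) :
  wprod (letter_mx w false) (letter_mx w true) u i j =
  ((j == i + size u :> nat)%N && (u == take (size u) (drop i w)))%:R.
Proof.
elim: u i => [|b u IH] i.
  rewrite /wprod big_nil mxE addn0 take0 eqxx andbT eq_sym.
  by rewrite -(inj_eq val_inj).
rewrite /wprod big_cons -/(wprod _ _ u) mxE.
have -> : (if b then letter_mx w true else letter_mx w false) = letter_mx w b.
  by case: b.
have [iw|iw] := ltnP i (size w); last first.
  rewrite big1 => [|l _].
    case: eqP => // ji; have := ltn_ord j; rewrite ji ltnS addnS => h.
    by have := leq_trans (leq_ltn_trans (leq_addr _ _) h) iw; rewrite ltnn.
  rewrite mxE; case: eqP => [li|]; last by rewrite mul0r.
  by have := ltn_ord l; rewrite li ltnS ltnNge iw.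
have i1 : (i.+1 < (size w).+1)%N by [].
rewrite (bigD1 (Ordinal i1)) //= big1 ?addr0 => [|l li]; last first.
  rewrite mxE; case: eqP => [e|]; last by rewrite mul0r.
  by case/eqP: li; apply: val_inj.
rewrite mxE IH /= eqxx addnS addSn (drop_nth false iw) /= eqseq_cons.
by rewrite -natrM mulnb andbCA [_ == b]eq_sym.
Qed.

Lemma wprod_letter_corner w u :
  wprod (letter_mx w false) (letter_mx w true) u ord0 ord_max = (u == w)%:R.
Proof.
rewrite wprod_letter /= add0n drop0; congr (nat_of_bool _)%:R.
apply/andP/eqP => [[/eqP <- /eqP ->]|->]; first by rewrite take_size.
by rewrite take_size.
Qed.

(** For words of length at most k, the coefficient of w in the noncommutative series log (e^x
    e^y). *)
Definition dcoef k w : F :=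
  elog k (letter_mx w false) (letter_mx w true) ord0 ord_max.

Lemma dcoefE k w : dcoef k w = dsum k (fun u => (u == w)%:R : F^o).
Proof.
rewrite /dcoef elog_dsum.
pose f (M : 'M[F]_((size w).+1)) : F^o := M ord0 ord_max.
have fl : linear f by move=> a A B; rewrite /f !mxE.
pose fL : {linear _ -> _} := HB.pack f (GRing.isLinear.Build _ _ _ _ _ fl).
rewrite -[LHS]/(fL _) linear_dsum.
by apply: eq_dsum => u; exact: wprod_letter_corner.
Qed.

(** Substituting - B for A and - A for B exchanges the two letters of a word and multiplies by the
    sign of its length. The identity is the corner entry of [elog_inv] at the matrices of w, whose
    size [(size w).+1] is at most k + 1. *)
Lemma dcoefN k w : (size w <= k)%N ->
  dsum k (fun u => (-1) ^+ size u * (map negb u == w)%:R : F^o) = - dcoef k w.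
Proof.
move=> wk.
have := elog_inv wk (@letter_mx_supper w false) (@letter_mx_supper w true).
move=> /(congr1 (fun M : 'M[F]_((size w).+1) => M ord0 ord_max)).
rewrite [in X in _ = X -> _]mxE -/(dcoef k w) => <-; rewrite elog_dsum.
pose f (M : 'M[F]_((size w).+1)) : F^o := M ord0 ord_max.
have fl : linear f by move=> a A B; rewrite /f !mxE.
pose fL : {linear _ -> _} := HB.pack f (GRing.isLinear.Build _ _ _ _ _ fl).
rewrite -[RHS]/(fL _) linear_dsum; apply: eq_dsum => u.
rewrite -wprod_letter_corner /= /f.
set A := letter_mx w false; set B := letter_mx w true.
suff -> : wprod (- B) (- A) u = (-1) ^+ size u *: wprod A B (map negb u).
  by rewrite mxE.
elim: u => [|b u IH]; first by rewrite /wprod !big_nil scale1r.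
rewrite /wprod /= !big_cons -!/(wprod _ _ _) IH exprS -scalerA -scalerAr scaleN1r.
by case: b => /=; rewrite mulNr scalerN.
Qed.

Lemma dsum_words k (U : lmodType F) (phi : seq bool -> U) :
  (forall u, (k < size u)%N -> phi u = 0) ->
  dsum k phi = \sum_(p < k.+1) \sum_(w : p.-tuple bool) dcoef k w *: phi w.
Proof.
move=> phi0.
have phiE u : phi u = \sum_(p < k.+1) \sum_(w : p.-tuple bool)
    ((u == w)%:R : F^o) *: phi w.
  have [uk|uk] := ltnP k (size u).
    rewrite phi0// big1// => p _; rewrite big1// => w _.
    case: eqP => [uw|]; last by rewrite scale0r.
    by move: uk; rewrite uw size_tuple ltnNge -ltnS ltn_ord.
  have uk' : (size u < k.+1)%N by [].
  rewrite (bigD1 (Ordinal uk')) //= [X in _ + X]big1 ?addr0 => [|p pu].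
    rewrite (bigD1 (in_tuple u)) //= eqxx scale1r big1 ?addr0// => w wu.
    case: eqP => [uw|]; last by rewrite scale0r.
    by case/eqP: wu; apply: val_inj.
  rewrite big1// => w _; case: eqP => [uw|]; last by rewrite scale0r.
  by case/eqP: pu; apply: val_inj => /=; rewrite uw size_tuple.
rewrite (eq_dsum _ phiE) dsum_sum; apply: eq_bigr => p _.
rewrite dsum_sum; apply: eq_bigr => w _.
by rewrite dsum_scale dcoefE.
Qed.

(** The identity holds for the coefficient of each word, hence for any assignment of vectors to
    words; [phi] will be the normalized nested bracket. *)
Lemma dsum_wordsN k (U : lmodType F) (phi : seq bool -> U) :
  (forall u, (k < size u)%N -> phi u = 0) ->
  dsum k (fun u => (-1) ^+ size u *: phi (map negb u)) = - dsum k phi.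
Proof.
move=> phi0; rewrite [in RHS]dsum_words//.
have phiE u : (-1) ^+ size u *: phi (map negb u) =
    \sum_(p < k.+1) \sum_(w : p.-tuple bool)
    ((-1) ^+ size u * (map negb u == w)%:R : F^o) *: phi w.
  have [uk|uk] := ltnP k (size u).
    rewrite phi0 ?size_map// scaler0 big1// => p _; rewrite big1// => w _.
    case: eqP => [uw|]; last by rewrite mulr0 scale0r.
    by move: uk; rewrite -(size_map negb) uw size_tuple ltnNge -ltnS ltn_ord.
  have uk' : (size (map negb u) < k.+1)%N by rewrite size_map.
  rewrite (bigD1 (Ordinal uk')) //= [X in _ + X]big1 ?addr0 => [|p pu].
    rewrite (bigD1 (in_tuple (map negb u))) //= eqxx mulr1 big1 ?addr0// => w wu.
    case: eqP => [uw|]; last by rewrite mulr0 scale0r.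
    by case/eqP: wu; apply: val_inj.
  rewrite big1// => w _; case: eqP => [uw|]; last by rewrite mulr0 scale0r.
  by case/eqP: pu; apply: val_inj => /=; rewrite uw size_tuple.
rewrite (eq_dsum _ phiE) dsum_sum -sumrN; apply: eq_bigr => p _.
rewrite dsum_sum -sumrN; apply: eq_bigr => w _.
by rewrite dsum_scale dcoefN ?scaleNr// size_tuple -ltnS.
Qed.

(** The matrices of a one-letter word are 2 by 2, so products of two of them vanish and only the
    linear terms survive. *)
Lemma dcoef1 k b : (0 < k)%N -> dcoef k [:: b] = 1.
Proof.
case: k => // k _; rewrite /dcoef /elog.
set A := letter_mx _ false; set B := letter_mx _ true.
have hA : supper 1 A by exact: letter_mx_supper.
have hB : supper 1 B by exact: letter_mx_supper.
have X0 n (X : 'M[F]_2) : supper 1 X -> X ^+ n.+2 = 0.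
  by move=> hX; apply: supper_eq0 (supper_exp hX).
rewrite big_ord_recl big1 ?addr0 => [|i _]; last first.
  by rewrite X0 ?scaler0//; exact: mexpM_supper.
rewrite expr0 divr1 scale1r expr1.
have E (X : 'M[F]_2) : supper 1 X -> mexp k.+1 X = 1 + X.
  move=> hX; rewrite mexpE big_ord_recl big_ord_recl big1 ?addr0 => [|i _].
    by rewrite /= !fact0 factS fact0 invr1 !scale1r expr0 expr1.
  by rewrite X0 ?scaler0.
rewrite !E// mulrDl mul1r mulrDr mulr1.
have -> : A * B = 0 by apply: supper_eq0 (supper_mul hA hB).
have -> : 1 + B + (A + 0) - 1 = B + A.
  by rewrite addr0 [LHS]addrC !addrA addNr add0r.
by rewrite !mxE /=; case: b {A B hA hB}; rewrite ?addr0 ?add0r.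
Qed.

End Words.

(** * Carnot algebras *)

Section CarnotAlgebra.
Context {R : realType} (G : carnotGroup R).
Local Notation n := (\sum_(j < step G) ldim G j)%N.
Local Notation V := 'rV[R]_n.
Local Notation br := (bracket G).
Local Notation k := (step G).

Definition wt (i : 'I_n) : nat := (tagnat.sig1 i).+1.

Lemma wt_gt0 i : (0 < wt i)%N. Proof. by []. Qed.

Lemma wt_le i : (wt i <= k)%N. Proof. exact: ltn_ord. Qed.

Definition homog (l : nat) (x : V) := forall i, wt i != l -> x 0 i = 0.

Lemma layerP l x : x \in layer (R := R) (ldim G) l <-> homog l x.
Proof.
split=> [xl i il|xl].
  rewrite /layer in xl; set s := map _ _ in xl.
  rewrite (coord_span (X := in_tuple s) xl) summxE big1// => j _.
  rewrite mxE /=; have /mapP[h hl ->] : s`_j \in s by rewrite mem_nth// size_tuple.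
  rewrite mxE eqxx /=; case: eqP => [ih|]; last by rewrite mulr0.
  by move: hl il; rewrite mem_filter -ih => /andP[/eqP + _] /eqP.
rewrite [x]row_sum_delta; apply: memv_suml => i _.
have [il|il] := eqVneq (wt i) l; last by rewrite xl// scale0r mem0v.
apply/memvZ/memv_span/map_f; rewrite mem_filter mem_enum andbT.
exact/eqP.
Qed.

Lemma homogD l x y : homog l x -> homog l y -> homog l (x + y).
Proof. by move=> hx hy i il; rewrite mxE hx// hy// addr0. Qed.

Lemma homogZ l c x : homog l x -> homog l (c *: x).
Proof. by move=> hx i il; rewrite mxE hx// mulr0. Qed.

Lemma homog0 l : homog l 0. Proof. by move=> i _; rewrite mxE. Qed.

Lemma homog_sum l (I : finType) (f : I -> V) :
  (forall i, homog l (f i)) -> homog l (\sum_i f i).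
Proof. by move=> hf; apply: big_ind => //; [exact: homog0|exact: homogD]. Qed.

Lemma homog_eq0 l x : (l == 0)%N || (k < l)%N -> homog l x -> x = 0.
Proof.
move=> l0 hx; apply/rowP => i; rewrite mxE hx//.
have := wt_le i; have := wt_gt0 i.
by case/orP: l0 => [/eqP ->|]; lia.
Qed.

Lemma bracket_suml (I : finType) (f : I -> V) y :
  br (\sum_i f i) y = \sum_i br (f i) y.
Proof.
have bl := bracket_linearl (c := G) y.
pose fL : {linear V -> V} := HB.pack (br^~ y) (GRing.isLinear.Build _ _ _ _ _ bl).
exact: (raddf_sum fL).
Qed.

Lemma bracket_sumr (I : finType) (f : I -> V) x :
  br x (\sum_i f i) = \sum_i br x (f i).
Proof.
have bl := bracket_linearr (c := G) x.
pose fL : {linear V -> V} := HB.pack (br x) (GRing.isLinear.Build _ _ _ _ _ bl).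
exact: (raddf_sum fL).
Qed.

Lemma bracketZl c x y : br (c *: x) y = c *: br x y.
Proof.
have bl := bracket_linearl (c := G) y.
pose fL : {linear V -> V} := HB.pack (br^~ y) (GRing.isLinear.Build _ _ _ _ _ bl).
exact: (linearZZ fL).
Qed.

Lemma bracketZr c x y : br x (c *: y) = c *: br x y.
Proof.
have bl := bracket_linearr (c := G) x.
pose fL : {linear V -> V} := HB.pack (br x) (GRing.isLinear.Build _ _ _ _ _ bl).
exact: (linearZZ fL).
Qed.

Lemma bracket0l y : br 0 y = 0.
Proof. by rewrite -(scale0r (0 : V)) bracketZl !scale0r. Qed.

Lemma bracket0r x : br x 0 = 0.
Proof. by rewrite -(scale0r (0 : V)) bracketZr !scale0r. Qed.

Lemma bracketDl x x' y : br (x + x') y = br x y + br x' y.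
Proof. by have := bracket_linearl (c := G) y 1 x x'; rewrite !scale1r. Qed.

Lemma bracketDr x y y' : br x (y + y') = br x y + br x y'.
Proof. by have := bracket_linearr (c := G) x 1 y y'; rewrite !scale1r. Qed.

Lemma bracketC x y : br x y = - br y x.
Proof.
have := bracketxx (c := G) (x + y).
rewrite bracketDl !bracketDr !bracketxx add0r addr0 => /eqP.
by rewrite addr_eq0 => /eqP.
Qed.

Lemma bracket_bracketl x y z : br (br x y) z = br x (br y z) - br y (br x z).
Proof.
have := bracket_jacobi (c := G) x y z.
rewrite [br z (br x y)]bracketC [br z x]bracketC -scaleN1r bracketZr scaleN1r.
by move/eqP; rewrite subr_eq0 => /eqP <-.
Qed.

Lemma memv_bracket (U W : {vspace V}) x y : x \in U -> y \in W ->
  br x y \in bracketv br U W.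
Proof.
move=> xU yW; rewrite (coord_vbasis xU) (coord_vbasis yW) bracket_suml.
apply: memv_suml => i _; rewrite bracket_sumr; apply: memv_suml => j _.
rewrite bracketZl bracketZr; do 2! apply: memvZ.
by apply/memv_span/allpairs_f; apply: mem_nth; rewrite size_tuple.
Qed.

Lemma bracket_layer1 j x y : homog 1 x -> homog j y -> homog j.+1 (br x y).
Proof.
move=> hx hy.
have [->|j0] := eqVneq y 0; first by rewrite bracket0r; exact: homog0.
have [jk|jk] := boolP ((j == 0)%N || (k < j)%N).
  by rewrite (homog_eq0 jk hy) bracket0r; exact: homog0.
have := memv_bracket (proj2 (layerP _ _) hx) (proj2 (layerP _ _) hy).
have [jk'|jk'] := ltnP j k.
  by rewrite bracket_layer ?jk'; [move/layerP|lia].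
have -> : j = k by lia.
by rewrite bracket_last memv0 => /eqP ->; exact: homog0.
Qed.

(** The stratification only describes brackets with the first layer. Layer i + 2 is spanned by
    brackets [p, q] with p in layer 1 and q in layer i + 1, and the Jacobi identity reduces [[p, q],
    y] to brackets covered by the induction on i. *)
Lemma bracket_homog i j x y : homog i x -> homog j y -> homog (i + j) (br x y).
Proof.
case: i x => [x hx _|i].
  by rewrite (homog_eq0 _ hx)// bracket0l; exact: homog0.
elim: i j y => [|i IH] j y x hx hy; first exact: bracket_layer1.
have [ik|ik] := ltnP k i.+2.
  by rewrite (homog_eq0 _ hx) ?ik ?orbT// bracket0l; exact: homog0.
have /layerP := hx; rewrite -bracket_layer// /bracketv => xs.
set s := (X in <<X>>%VS) in xs.
rewrite (coord_span (X := in_tuple s) xs) bracket_suml; apply: homog_sum => a.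
rewrite bracketZl /=; apply: homogZ.
have /allpairsP[[p q] /= [ps qs ->]] : s`_a \in s by rewrite mem_nth// size_tuple.
have {}ps : homog 1 p by apply/layerP; exact: vbasis_mem.
have {}qs : homog i.+1 q by apply/layerP; exact: vbasis_mem.
rewrite bracket_bracketl -scaleN1r; apply: homogD.
  by rewrite addSn; apply: bracket_layer1 => //; exact: IH.
apply: homogZ; rewrite addSnnS; apply: IH => //.
exact: bracket_layer1.
Qed.

Definition strc a b h : R := br (delta_mx 0 a) (delta_mx 0 b) 0 h.

Lemma strc_neq0 a b h : strc a b h != 0 -> wt h = (wt a + wt b)%N.
Proof.
apply: contra_neq_eq => hab.
have hd c : homog (wt c) (delta_mx 0 c).
  move=> i ic; rewrite mxE eqxx /=; case: eqP => // e.
  by rewrite e eqxx in ic.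
exact: (bracket_homog (hd a) (hd b)).
Qed.

Lemma bracketE x y h :
  br x y 0 h = \sum_a \sum_b x 0 a * y 0 b * strc a b h.
Proof.
rewrite {1}[x]row_sum_delta bracket_suml summxE; apply: eq_bigr => a _.
rewrite {1}[y]row_sum_delta bracket_sumr summxE; apply: eq_bigr => b _.
by rewrite bracketZl bracketZr !mxE mulrA.
Qed.

Definition agree (l : nat) (x y : V) := forall i, (wt i <= l)%N -> x 0 i = y 0 i.

(** A coordinate of the bracket only involves products of coordinates whose weights are positive and
    add up to its own, hence are smaller. This gain of one layer is what makes equations in the
    group triangular. *)
Lemma bracket_agree l x x' y y' : agree l x x' -> agree l y y' ->
  agree l.+1 (br x y) (br x' y').
Proof.
move=> hx hy h hl; rewrite !bracketE; apply: eq_bigr => a _.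
apply: eq_bigr => b _.
have [->|/strc_neq0 e] := eqVneq (strc a b h) 0; first by rewrite !mulr0.
have := wt_gt0 a; have := wt_gt0 b => b0 a0.
by rewrite hx ?hy//; lia.
Qed.

Definition letter (x y : V) (b : bool) := if b then y else x.

Definition nbr x y (w : seq bool) : V := nested_bracket (map (letter x y) w).

Lemma nbr_cons x y b c w :
  nbr x y [:: b, c & w] = br (letter x y b) (nbr x y (c :: w)).
Proof. by []. Qed.

Lemma letter_agree l x x' y y' b : agree l x x' -> agree l y y' ->
  agree l (letter x y b) (letter x' y' b).
Proof. by case: b. Qed.

Lemma agree_le l l' x y : (l <= l')%N -> agree l' x y -> agree l x y.
Proof. by move=> ll h i il; apply: h; exact: leq_trans ll. Qed.

Lemma nbr_agree l x x' y y' w : agree l x x' -> agree l y y' ->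
  agree l (nbr x y w) (nbr x' y' w).
Proof.
move=> hx hy; elim: w => [//|b [|c w] IH]; first exact: letter_agree.
rewrite !nbr_cons; apply: (@agree_le _ l.+1) => //.
by apply: bracket_agree => //; exact: letter_agree.
Qed.

Lemma nbr_agreeS l x x' y y' w : (1 < size w)%N ->
  agree l x x' -> agree l y y' -> agree l.+1 (nbr x y w) (nbr x' y' w).
Proof.
case: w => [//|b [//|c w]] _ hx hy; rewrite !nbr_cons.
by apply: bracket_agree; [exact: letter_agree|exact: nbr_agree].
Qed.

Lemma nbr_low x y w h : (wt h < size w)%N -> nbr x y w 0 h = 0.
Proof.
elim: w h => [//|b [|c w] IH] h; first by rewrite ltnS leqn0.
rewrite nbr_cons bracketE => hw; rewrite big1// => a _; rewrite big1// => d _.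
have [->|/strc_neq0 e] := eqVneq (strc a d h) 0; first by rewrite !mulr0.
rewrite IH ?mulr0 ?mul0r// -ltnS (leq_trans _ hw)// e.
by have := wt_gt0 a; rewrite ltnS; lia.
Qed.

Lemma nbr_nil x y w : (k < size w)%N -> nbr x y w = 0.
Proof.
move=> kw; apply/rowP => h; rewrite nbr_low ?mxE//.
exact: leq_ltn_trans (wt_le _) kw.
Qed.

Definition dterm x y (w : seq bool) : V := (size w)%:R^-1 *: nbr x y w.

Lemma dynkin_wordE m K (rs : {ffun 'I_m -> 'I_K * 'I_K}) (x y : V) :
  dynkin_word rs x y = map (letter x y) (bword rs).
Proof.
rewrite /dynkin_word /bword map_flatten -map_comp; congr flatten.
by apply: eq_map => i /=; rewrite map_cat !map_nseq.
Qed.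

Lemma cmulE x y : cmul G x y = dsum k (dterm x y).
Proof.
apply: eq_bigr => m _; congr (_ *: _); apply: eq_bigr => rs _.
by rewrite natrM invfM -size_bword mulrC -scalerA dynkin_wordE.
Qed.

Lemma nbrN x y w : nbr (- y) (- x) w = (-1) ^+ size w *: nbr x y (map negb w).
Proof.
have lN b : letter (- y) (- x) b = - letter x y (~~ b) by case: b.
elim: w => [|b [|c w] IH]; first by rewrite scaler0.
  by rewrite /nbr /= lN expr1 scaleN1r.
rewrite nbr_cons IH lN bracketZr -[- letter _ _ _]scaleN1r bracketZl scalerA -exprSr.
by rewrite !map_cons nbr_cons.
Qed.

Lemma cmulN x y : cmul G (- y) (- x) = - cmul G x y.
Proof.
rewrite !cmulE -dsum_wordsN => [|u ku]; last by rewrite /dterm nbr_nil ?scaler0.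
apply: eq_dsum => u; rewrite /dterm nbrN size_map !scalerA.
by rewrite [X in X *: _]mulrC.
Qed.

(** The nonlinear part of the group law, collected by words of length at least 2. *)
Definition crest x y : V := \sum_(p < k.+1 | (1 < p)%N)
  \sum_(w : p.-tuple bool) dcoef k w *: dterm x y w.

Lemma cmul_rest x y : (0 < k)%N -> cmul G x y = x + y + crest x y.
Proof.
move=> k0; rewrite cmulE dsum_words => [|u ku]; last by rewrite /dterm nbr_nil ?scaler0.
rewrite /crest (bigID (fun p : 'I_k.+1 => (1 < p)%N)) /= addrC; congr (_ + _).
have k1 : (1 < k.+1)%N by [].
(* The empty word contributes 0: its length is 0, and the inverse of 0 is 0. *)
rewrite (bigD1 ord0) //= [X in X + _]big1 ?add0r => [|w _]; last first.
  by rewrite tuple0 /dterm /= invr0 scale0r scaler0.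
rewrite (bigD1 (Ordinal k1)) //= [X in _ + X]big_pred0 ?addr0 => [|i]; last first.
  by case: i => -[|[|i]] ik.
have -> : \sum_(w : 1.-tuple bool) dcoef k w *: dterm x y w =
  \sum_(b : bool) dcoef k [:: b] *: dterm x y [:: b].
  rewrite (reindex (fun b : bool => [tuple b])) //=.
  exists (fun w : 1.-tuple bool => thead w) => [//|w _].
  by case/tupleP: w => b w; rewrite tuple0 theadE.
rewrite big_bool !dcoef1// !scale1r /dterm /= invr1 !scale1r addrC.
by [].
Qed.

Lemma crest_agree l x x' y y' : agree l x x' -> agree l y y' ->
  agree l.+1 (crest x y) (crest x' y').
Proof.
move=> hx hy h hl; rewrite /crest !summxE; apply: eq_bigr => p p1.
rewrite !summxE; apply: eq_bigr => w _; rewrite !mxE.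
by rewrite (@nbr_agreeS l x x' y y')// size_tuple.
Qed.

End CarnotAlgebra.

(** * Size estimates and equations for the group law *)

Section CarnotEstimates.
Context {R : realType} (G : carnotGroup R).
Local Notation n := (\sum_(j < step G) ldim G j)%N.
Local Notation V := 'rV[R]_n.
Local Notation br := (bracket G).
Local Notation k := (step G).

(** Membership in a box adapted to the dilations. The factor M absorbs the constants of sums and
    brackets; as every weight is at least 1, a factor M >= 1 can be traded for the dilation from rho
    to M rho. *)
Definition bdd (M rho : R) (x : V) := forall i, `|x 0 i| <= M * rho ^+ wt i.

Lemma bdd_le M M' rho x : 0 <= rho -> M <= M' -> bdd M rho x -> bdd M' rho x.
Proof.
move=> r0 MM hx i; apply: le_trans (hx i) _.
by rewrite ler_wpM2r// exprn_ge0.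
Qed.

Lemma bddD M M' rho x y : bdd M rho x -> bdd M' rho y -> bdd (M + M') rho (x + y).
Proof.
move=> hx hy i; rewrite mxE mulrDl; apply: le_trans (ler_normD _ _) _.
exact: lerD.
Qed.

Lemma bddZ c M rho x : bdd M rho x -> bdd (`|c| * M) rho (c *: x).
Proof. by move=> hx i; rewrite mxE normrM -mulrA ler_wpM2l. Qed.

Lemma bdd_sum (I : Type) (s : seq I) (P : pred I) (M : I -> R) rho (f : I -> V) :
  (forall i, P i -> bdd (M i) rho (f i)) ->
  bdd (\sum_(i <- s | P i) M i) rho (\sum_(i <- s | P i) f i).
Proof.
move=> h; elim/big_ind2: _ => //; last by move=> *; exact: bddD.
by move=> i; rewrite mxE normr0 mul0r.
Qed.

Lemma bddN M rho x : bdd M rho x -> bdd M rho (- x).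
Proof. by move=> hx i; rewrite mxE normrN. Qed.

Lemma bdd_scale M rho x : 1 <= M -> 0 <= rho -> bdd M rho x -> bdd 1 (M * rho) x.
Proof.
move=> M1 r0 hx i; apply: le_trans (hx i) _; rewrite mul1r exprMn.
by rewrite ler_wpM2r ?exprn_ge0// ler_eXnr.
Qed.

Definition strc_norm : R := 1 + \sum_h \sum_a \sum_b `|strc (G := G) a b h|.

Lemma strc_norm_ge1 : 1 <= strc_norm.
Proof. by rewrite lerDl; do 3! apply: sumr_ge0 => ? _. Qed.

(** A nonzero structure constant forces wt h = wt a + wt b, so the powers of rho match and the
    constant does not depend on rho. *)
Lemma bdd_bracket M M' rho x y : 0 <= M -> 0 <= M' -> 0 <= rho ->
  bdd M rho x -> bdd M' rho y -> bdd (strc_norm * (M * M')) rho (br x y).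
Proof.
move=> M0 M'0 r0 hx hy h; rewrite bracketE.
apply: (@le_trans _ _ (\sum_a \sum_b `|strc (G := G) a b h| * (M * M' * rho ^+ wt h))).
  apply: le_trans (ler_norm_sum _ _ _) _; apply: ler_sum => a _.
  apply: le_trans (ler_norm_sum _ _ _) _; apply: ler_sum => b _.
  have [->|/strc_neq0 e] := eqVneq (strc a b h) 0; first by rewrite mulr0 normr0 mul0r.
  rewrite normrM mulrC ler_wpM2l// e exprD mulrACA normrM.
  exact: ler_pM (hx a) (hy b).
under eq_bigr do rewrite -mulr_suml; rewrite -mulr_suml mulrA.
apply: ler_wpM2r; first exact: exprn_ge0.
apply: ler_wpM2r; first exact: mulr_ge0.
rewrite /strc_norm [X in _ <= 1 + X](bigD1 h) //= addrCA lerDl addr_ge0//.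
by do 3! apply: sumr_ge0 => ? _.
Qed.

Lemma bdd_nbr rho x y w : 0 <= rho -> bdd 1 rho x -> bdd 1 rho y ->
  bdd (strc_norm ^+ size w) rho (nbr x y w).
Proof.
move=> r0 hx hy; have K1 := strc_norm_ge1; have K0 := le_trans ler01 K1.
have hl b : bdd 1 rho (letter x y b) by case: b.
elim: w => [|b [|c w] IH].
- by move=> i; rewrite mxE normr0 mulr_ge0 ?exprn_ge0.
- by rewrite expr1; apply: (bdd_le r0 K1); exact: hl.
- rewrite nbr_cons exprS -[_ ^+ _]mul1r.
  by apply: bdd_bracket => //; exact: exprn_ge0.
Qed.

Lemma bdd_crest : exists2 M : R, 1 <= M & forall rho x y, 0 <= rho ->
  bdd 1 rho x -> bdd 1 rho y -> bdd M rho (crest (G := G) x y).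
Proof.
pose M1 : R := \sum_(p < k.+1 | (1 < p)%N) \sum_(w : p.-tuple bool)
  `|dcoef (F := R) k w| * (`|(size w)%:R^-1| * strc_norm ^+ size w).
have M10 : 0 <= M1.
  have K0 := le_trans ler01 strc_norm_ge1.
  apply: sumr_ge0 => p _; apply: sumr_ge0 => w _.
  by rewrite !mulr_ge0 ?exprn_ge0.
exists (1 + M1) => [|rho x y r0 hx hy]; first by rewrite lerDl.
apply: (@bdd_le M1) => //; first by rewrite lerDr.
apply: bdd_sum => p _; apply: bdd_sum => w _.
by do 2! apply: bddZ; exact: bdd_nbr.
Qed.

Lemma bdd_cmul : (0 < k)%N -> exists2 M : R, 1 <= M & forall rho x y, 0 <= rho ->
  bdd 1 rho x -> bdd 1 rho y -> bdd 1 (M * rho) (cmul G x y).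
Proof.
move=> k0; have [M M1 hM] := bdd_crest.
exists (1 + 1 + M) => [|rho x y r0 hx hy]; first by lra.
apply: bdd_scale => //; first by lra.
by rewrite cmul_rest//; apply: bddD; [exact: bddD|exact: hM].
Qed.

(* In the equation cmul u v = w the layers of v are determined one after the
   other, so no inverse of u is needed. *)
Lemma bdd_cmul_solve : (0 < k)%N -> exists2 M : R, 1 <= M & forall rho u v,
  0 <= rho -> bdd 1 rho u -> bdd 1 rho (cmul G u v) -> bdd 1 (M * rho) v.
Proof.
move=> k0; have [K K1 hK] := bdd_crest.
have /(_ k)[M [M1 hM]] : forall l, exists M : R, 1 <= M /\ forall rho u v,
  0 <= rho -> bdd 1 rho u -> bdd 1 rho (cmul G u v) ->
  forall i, (wt i <= l)%N -> `|v 0 i| <= (M * rho) ^+ wt i.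
  elim=> [|l [M [M1 IH]]].
    by exists 1; split => // rho u v _ _ _ i; rewrite leqn0.
  exists ((1 + 1 + K) * M); split.
    by rewrite mulr_ege1//; lra.
  move=> rho u v r0 hu huv i il.
  have M0 : 0 <= M by lra.
  (* Layer l + 1 of [crest u v] only sees the layers of v up to l, so v may be cut down to the part
     that is already bounded. *)
  pose v' : V := \row_j (if (wt j <= l)%N then v 0 j else 0).
  have hv' : bdd 1 (M * rho) v'.
    move=> j; rewrite mul1r mxE; case: ifPn => jl; first exact: IH jl.
    by rewrite normr0 exprn_ge0// mulr_ge0.
  have rM : rho <= M * rho by rewrite ler_peMl.
  have hu' : bdd 1 (M * rho) u.
    move=> j; apply: le_trans (hu j) _; rewrite !mul1r.
    by apply: lerXn2r => //; rewrite nnegrE// mulr_ge0.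
  have huv' : bdd 1 (M * rho) (cmul G u v).
    move=> j; apply: le_trans (huv j) _; rewrite !mul1r.
    by apply: lerXn2r => //; rewrite nnegrE// mulr_ge0.
  have cr : crest (G := G) u v 0 i = crest (G := G) u v' 0 i.
    apply: (@crest_agree _ _ l) => // j jl; by rewrite mxE jl.
  have -> : v 0 i = (cmul G u v + - u + - crest (G := G) u v') 0 i.
    by rewrite cmul_rest// !mxE cr; lra.
  have Mr0 : 0 <= M * rho by rewrite mulr_ge0.
  have := bddD (bddD huv' (bddN hu')) (bddN (hK _ _ _ Mr0 hu' hv')).
  have K3 : 1 <= 1 + 1 + K by lra.
  by move=> /(bdd_scale K3 Mr0)/(_ i); rewrite mul1r mulrA.
exists M => // rho u v r0 hu huv i; rewrite mul1r.
by apply: hM => //; exact: wt_le.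
Qed.

Section Triangular.
Variable Phi : V -> V.
Hypothesis Phi_agree : forall l x y, agree l x y -> agree l.+1 (Phi x) (Phi y).

(** Each iteration settles one more layer, so after k of them the starting point is forgotten.
    Existence and uniqueness of the fixed point follow. *)
Lemma iter_agree x y m : agree m (iter m Phi x) (iter m Phi y).
Proof.
elim: m => [i|m IH]; first by rewrite leqNgt wt_gt0.
exact: Phi_agree.
Qed.

Lemma triangular_fixpoint x : Phi (iter k Phi x) = iter k Phi x.
Proof.
apply/rowP => i; rewrite -iterS iterSr.
by apply: (iter_agree (Phi x) x (wt_le i)).
Qed.

Lemma triangular_unique x y : Phi x = x -> Phi y = y -> x = y.
Proof.
move=> hx hy; apply/rowP => i; have := @iter_agree x y k i (wt_le i).
by rewrite !iter_fix.
Qed.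

End Triangular.

(** The solution y of x y = z, obtained as the fixed point of y = z - x - [crest x y]; the formula
    (-x) z would call for associativity. *)
Definition linv (x z : V) : V :=
  iter k (fun y => z - x - crest (G := G) x y) 0.

Lemma linv_agree x z l y y' : agree l y y' ->
  agree l.+1 (z - x - crest (G := G) x y) (z - x - crest (G := G) x y').
Proof.
move=> h i il; rewrite !mxE; congr (_ + _); congr (- _).
by apply: (crest_agree _ h).
Qed.

Lemma cmul_linv x z : (0 < k)%N -> cmul G x (linv x z) = z.
Proof.
move=> k0; have := triangular_fixpoint (@linv_agree x z) 0.
rewrite cmul_rest// -/(linv x z) => {1}<-.
by rewrite addrA subrK addrC subrK.
Qed.

Lemma cmul_inj x : (0 < k)%N -> injective (cmul G x).
Proof.
move=> k0 y y' e; apply: (triangular_unique (@linv_agree x (cmul G x y))).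
  by rewrite cmul_rest// addrAC addrK addrAC subrr add0r.
by rewrite e cmul_rest// addrAC addrK addrAC subrr add0r.
Qed.

Lemma linvK x y : (0 < k)%N -> linv x (cmul G x y) = y.
Proof. by move=> k0; apply: (@cmul_inj x k0); rewrite cmul_linv. Qed.

Section Measurability.
Context {d : measure_display} {T : measurableType d}.
Implicit Types f g : T -> V.

(** Coordinatewise measurability. The group law and the norm are built from coordinates, so it
    suffices for them, also for maps defined on the product of two copies of the group. *)
Definition cmf f := forall i, measurable_fun [set: T] (fun t => f t 0 i).

Lemma cmf_cst x : cmf (fun=> x).
Proof. by move=> i; exact: measurable_cst. Qed.

Lemma cmfD f g : cmf f -> cmf g -> cmf (fun t => f t + g t).
Proof.
move=> hf hg i; under eq_fun do rewrite mxE.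
exact: measurable_funD.
Qed.

Lemma cmfZ c f : cmf f -> cmf (fun t => c *: f t).
Proof.
move=> hf i; under eq_fun do rewrite mxE.
exact: measurable_funM.
Qed.

Lemma cmfN f : cmf f -> cmf (fun t => - f t).
Proof.
by move=> hf; under eq_fun do rewrite -scaleN1r; exact: cmfZ.
Qed.

Lemma cmf_sum (I : Type) (s : seq I) (P : pred I) (f : I -> T -> V) :
  (forall i, cmf (f i)) -> cmf (fun t => \sum_(i <- s | P i) f i t).
Proof.
move=> hf; elim: s => [|a s IH].
  by under eq_fun do rewrite big_nil; exact: cmf_cst.
under eq_fun do rewrite big_cons; case: (P a) => //.
exact: cmfD.
Qed.

Lemma cmf_bracket f g : cmf f -> cmf g -> cmf (fun t => br (f t) (g t)).
Proof.
move=> hf hg h; under eq_fun do rewrite bracketE.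
apply: measurable_sum => a; apply: measurable_sum => b.
by apply: measurable_funM => //; exact: measurable_funM.
Qed.

Lemma cmf_nbr f g w : cmf f -> cmf g -> cmf (fun t => nbr (f t) (g t) w).
Proof.
move=> hf hg; have hl b : cmf (fun t => letter (f t) (g t) b) by case: b.
elim: w => [|b [|c w] IH]; [exact: cmf_cst|exact: hl|].
exact: cmf_bracket (hl b) IH.
Qed.

Lemma cmf_crest f g : cmf f -> cmf g -> cmf (fun t => crest (G := G) (f t) (g t)).
Proof.
move=> hf hg; apply: cmf_sum => p; apply: cmf_sum => w.
by do 2! apply: cmfZ; exact: cmf_nbr.
Qed.

Lemma cmf_cmul f g : (0 < k)%N -> cmf f -> cmf g -> cmf (fun t => cmul G (f t) (g t)).
Proof.
move=> k0 hf hg; under eq_fun do rewrite cmul_rest//.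
by apply: cmfD; [exact: cmfD|exact: cmf_crest].
Qed.

Lemma cmf_linv x f : cmf f -> cmf (fun t => linv x (f t)).
Proof.
move=> hf; rewrite /linv; elim: (k in iter k) => [|l IH]; first exact: cmf_cst.
apply: cmfD; first by apply: cmfD => //; exact: cmf_cst.
by apply/cmfN/cmf_crest => //; exact: cmf_cst.
Qed.

End Measurability.

End CarnotEstimates.

(** * Volume growth *)

Lemma fsbigT_const (R : realDomainType) (I : finType) (m : \bar R) :
  (\sum_(i \in [set: I]) m)%E = (#|I|%:R%:E * m)%E.
Proof.
have -> : [set: I] = [set` index_enum I].
  by apply/seteqP; split=> i //= _; exact: mem_index_enum.
by rewrite -fsbig_seq ?index_enum_uniq// sumr_const mule_natl.
Qed.

Section HaarVolume.
Context {R : realType} (G : carnotGroup R).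
Local Notation n := (\sum_(j < step G) ldim G j)%N.
Local Notation V := 'rV[R]_n.
Local Notation k := (step G).
Local Notation wt := (@wt R G).

Lemma hdim_wt : hdim G = (\sum_i wt i)%N.
Proof.
transitivity (\sum_(j < k) \sum_(a < ldim G j) j.+1)%N.
  by apply: eq_bigr => j _; rewrite sum_nat_const card_ord mulnC.
rewrite sig_big_dep /= (reindex tagnat.sig) /=; first by [].
exact: onW_bij tagnat.sig_bij.
Qed.

Lemma hdim_step : (0 < hdim G)%N -> (0 < k)%N.
Proof.
rewrite hdim_wt; case: (posnP k) => // k0.
rewrite big1 // => i _; have := wt_le i; have := wt_gt0 i; rewrite k0.
by rewrite leqn0 => /lt0n_neq0 /negbTE ->.
Qed.

Lemma cmf_id : cmf (fun x : carnot G => x).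
Proof.
move=> i; apply: (measurability _ (RGenOInfty.measurableE R)).
move=> _ [_ [x ->] <-]; rewrite setTI; apply: sub_sigma_algebra.
rewrite /copen /=; apply: open_comp => [v _|]; first exact: coord_continuous.
exact: rray_open.
Qed.

(* The cells of the tiling: the translates of [cell r] by the points of
   \prod_i (2 r^(wt i) Z) are pairwise disjoint and cover the group. *)
Definition cell (r : R) : set (carnot G) :=
  [set x : V | forall i, - r ^+ wt i <= x 0 i < r ^+ wt i].

Lemma measurable_coord (P : 'I_n -> set R) : (forall i, measurable (P i)) ->
  measurable ([set x : V | forall i, P i (x 0 i)] : set (carnot G)).
Proof.
move=> mP.
have -> : ([set x : V | forall i, P i (x 0 i)] : set (carnot G)) =
  \bigcap_(i in [set: 'I_n]) [set x : carnot G | P i ((x : V) 0 i)].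
  by apply/seteqP; split=> x /= h i => [_|]; exact: h.
apply: fin_bigcap_measurable => [|i _]; first exact: finite_finset.
by rewrite -[X in measurable X]setTI; apply: cmf_id.
Qed.

Lemma measurable_cell r : measurable (cell r).
Proof.
have -> : cell r = [set x : V | forall i,
    (`[- r ^+ wt i, r ^+ wt i[%classic : set R) (x 0 i)].
  by apply/seteqP; split=> x h i; have := h i; rewrite /= in_itv.
by apply: (measurable_coord (P := fun i => `[- r ^+ wt i, r ^+ wt i[%classic)).
Qed.

Definition bbox (M r : R) : set (carnot G) := [set x : V | bdd M r x].

Lemma bboxE M r : bbox M r = [set x : V | forall i,
  (`[- (M * r ^+ wt i), M * r ^+ wt i]%classic : set R) (x 0 i)].
Proof. by apply/seteqP; split=> x h i; have := h i; rewrite /= in_itv /= ler_norml. Qed.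

Lemma measurable_bbox M r : measurable (bbox M r).
Proof.
rewrite bboxE.
by apply: (measurable_coord (P := fun i => `[- (M * r ^+ wt i), M * r ^+ wt i]%classic)).
Qed.

Lemma compact_bbox M r : compact (bbox M r : set V).
Proof.
rewrite bboxE.
apply: (rV_compact (A := fun i => `[- (M * r ^+ wt i), M * r ^+ wt i]%classic)).
by move=> i; exact: segment_compact.
Qed.

Lemma cell_bbox r : cell r `<=` bbox 1 r.
Proof. by move=> x h i; rewrite mul1r ler_norml; have /andP[-> /ltW ->] := h i. Qed.

Lemma cmul_image x (A : set (carnot G)) : (0 < k)%N ->
  [set cmul G x y | y in A] = linv x @^-1` A.
Proof.
move=> k0; apply/seteqP; split=> [_ [y Ay <-]|z /= Az]; first by rewrite /= linvK.
by exists (linv x z) => //; exact: cmul_linv.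
Qed.

Lemma measurable_cell_translate x r : (0 < k)%N ->
  measurable ([set cmul G x y | y in cell r] : set (carnot G)).
Proof.
move=> k0; rewrite cmul_image//.
have -> : linv x @^-1` cell r = \bigcap_(i in [set: 'I_n]) [set z : carnot G |
    (`[- r ^+ wt i, r ^+ wt i[%classic : set R) (linv x z 0 i)].
  apply/seteqP; split=> z h i; first by move=> _; have := h i; rewrite /= in_itv.
  by have := h i I; rewrite /= in_itv.
apply: fin_bigcap_measurable => [|i _]; first exact: finite_finset.
rewrite -[X in measurable X]setTI; by apply: (cmf_linv x cmf_id).
Qed.

Section Lattice.
Variable M : nat.

Definition lattice_index := {dffun forall i : 'I_n, 'I_(M ^ wt i)%N}.

Lemma card_lattice_index : #|lattice_index| = (M ^ hdim G)%N.
Proof.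
rewrite card_dep_ffun foldrE big_map big_enum_fin hdim_wt expn_sum.
by apply: eq_bigr => i _; rewrite card_ord.
Qed.

End Lattice.

Variable mu : {measure set (carnot G) -> \bar R}.
Hypothesis hmu : is_haar G mu.

Lemma haar_cell_translate x r : mu [set cmul G x y | y in cell r] = mu (cell r).
Proof. by case: hmu => + _ _; apply; exact: measurable_cell. Qed.

Lemma haar_bbox_fin M r : (mu (bbox M r) < +oo)%E.
Proof. by case: hmu => _ + _; apply; exact: compact_bbox. Qed.

(** The M^Q translates of [cell r] by the lattice points with 0 <= kap i < M^(wt i) are disjoint,
    have equal measure by left invariance, and lie in a box of size comparable to M r. *)
Lemma packing : (0 < k)%N -> exists2 C : R, 1 <= C & forall (M : nat) r,
  (0 < M)%N -> 0 < r ->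
  ((M ^ hdim G)%:R%:E * mu (cell r) <= mu (bbox 1 (C * (M%:R * r))))%E.
Proof.
move=> k0; have [K K1 hK] := bdd_cmul k0.
(* A lattice coordinate is at most 2 (M r)^w <= (2 M r)^w, which gives the 2; K is the constant of
   the product. *)
exists (K * 2) => [|M r M0 r0]; first by rewrite mulr_ege1//; lra.
pose lat (kap : lattice_index M) : V := \row_i (2 * r ^+ wt i * (kap i)%:R).
rewrite -card_lattice_index -fsbigT_const.
have -> : (\sum_(i \in [set: lattice_index M]) mu (cell r))%E =
  (\sum_(i \in [set: lattice_index M]) mu [set cmul G (lat i) y | y in cell r])%E.
  by apply: eq_fsbigr => i _; rewrite haar_cell_translate.
(* Once the lower layers agree the nonlinear parts agree, and 2 c kap + a = 2 c kap' + a' with a and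
   a' in [-c, c) forces kap = kap' and a = a' in the next layer. *)
have disj kap kap' a a' : cell r a -> cell r a' ->
    cmul G (lat kap) a = cmul G (lat kap') a' -> kap = kap'.
  move=> ha ha' e.
  have step l i : agree l (lat kap) (lat kap') -> agree l a a' ->
      (wt i <= l.+1)%N -> kap i = kap' i /\ a 0 i = a' 0 i.
    move=> hl hal il; have cr := crest_agree hl hal il.
    have := congr1 (fun v : V => v 0 i) e; rewrite /= !cmul_rest// !mxE cr => /addIr ei.
    have /andP[h1 h2] := ha i; have /andP[h3 h4] := ha' i.
    set c := r ^+ wt i in ei h1 h2 h3 h4; have c0 : 0 < c by exact: exprn_gt0.
    have [kk|kk|kk] := ltngtP (kap i) (kap' i).
    - have : (kap i)%:R + 1 <= (kap' i)%:R :> R by rewrite natr1 ler_nat.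
      by move=> h; exfalso; nra.
    - have : (kap' i)%:R + 1 <= (kap i)%:R :> R by rewrite natr1 ler_nat.
      by move=> h; exfalso; nra.
    - by split; [exact: val_inj|move: ei; rewrite kk => /addrI].
  have ag l : agree l (lat kap) (lat kap') /\ agree l a a'.
    elim: l => [|l [IH1 IH2]].
      by split=> i; rewrite leqNgt wt_gt0.
    split=> i il; have [e1 e2] := step l i IH1 IH2 il => //.
    by rewrite !mxE e1.
  apply/ffunP => i.
  by have [] := step k i (ag k).1 (ag k).2 (leqW (wt_le i)).
rewrite -measure_fin_bigcup; last first.
- by move=> kap _; exact: measurable_cell_translate.
- by move=> kap kap' _ _ [x [[a ha <-] [a' ha' /esym]]]; exact: disj.
- exact: finite_finset.
apply: le_measure.
- rewrite inE; apply: fin_bigcup_measurable; first exact: finite_finset.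
  by move=> i _; exact: measurable_cell_translate.
- by rewrite inE; exact: measurable_bbox.
have Mr0 : 0 <= M%:R * r by rewrite mulr_ge0// ltW.
move=> _ [kap _ [a ha <-]]; rewrite /bbox /= -mulrA; apply: hK.
- by rewrite mulr_ge0.
- apply: bdd_scale => // [|i]; first by lra.
  rewrite mxE ger0_norm ?mulr_ge0 ?exprn_ge0 ?(ltW r0)// -mulrA ler_wpM2l//.
  rewrite exprMn mulrC ler_wpM2r ?exprn_ge0 ?(ltW r0)// -natrX ler_nat ltnW//.
- move=> i; apply: le_trans (cell_bbox ha i) _; rewrite !mul1r.
  apply: lerXn2r; rewrite ?nnegrE ?(ltW r0)//; first by rewrite mulr_ge0.
  have : 1 <= M%:R :> R by rewrite ler1n.
  by move=> h; nra.
Qed.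

(** With x the rounding of an unknown s to the lattice of even integers and a = s - x, the equation
    x a = w reads s = w - [crest x a], which is triangular in s. *)
Lemma cell_decomposition (w : V) : (0 < k)%N -> exists x a : V,
  [/\ cmul G x a = w, cell 1 a & forall i, exists z : int, x 0 i = 2 * z%:~R].
Proof.
move=> k0.
pose lat (s : V) : V := \row_i (2 * (Num.floor ((s 0 i + 1) / 2))%:~R).
pose Phi (s : V) : V := w - crest (G := G) (lat s) (s - lat s).
have hPhi l s s' : agree l s s' -> agree l.+1 (Phi s) (Phi s').
  move=> h i il; rewrite !mxE; congr (_ - _).
  apply: (@crest_agree _ _ l) => // j jl; first by rewrite !mxE h.
  by rewrite !mxE h.
have := triangular_fixpoint hPhi 0; set s := iter _ _ _ => hs.
exists (lat s), (s - lat s); split.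
- by rewrite cmul_rest// [lat s + _]addrC subrK -{1}hs /Phi subrK.
- move=> i; rewrite expr1n !mxE.
  set t := (s 0 i + 1) / 2.
  have h1 := floor_le t; have h2 := floorD1_gt t.
  rewrite intrD1 in h2.
  have e : s 0 i = 2 * t - 1 by rewrite /t; lra.
  by rewrite e; apply/andP; split; lra.
- by move=> i; exists (Num.floor ((s 0 i + 1) / 2)); rewrite mxE.
Qed.

(** Every point of [cell N] is x a with a in [cell 1] and x in the lattice; x has size at most a
    multiple of N, which leaves at most (C N)^Q lattice points. *)
Lemma covering : (0 < k)%N -> exists C : nat, forall N : nat,
  (0 < N)%N -> (mu (cell N%:R) <= ((C * N) ^ hdim G)%:R%:E * mu (cell 1))%E.
Proof.
move=> k0; have [K K1 hK] := bdd_cmul_solve k0.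
pose K0 := (Num.truncn K).+1.
have KK0 : K <= K0%:R by rewrite ltW// truncnS_gt.
exists (3 * K0)%N => N N0; set M := (3 * K0 * N)%N.
(* The integers of absolute value at most [D i], shifted by [D i], become indices from 0 to 2 [D i];
   the factor 3 in M ensures 2 [D i] < M^(wt i). *)
pose D (i : 'I_n) := ((K0 * N) ^ wt i)%N.
pose lat (kap : lattice_index M) : V := \row_i (2 * ((kap i)%:R - (D i)%:R)).
rewrite -card_lattice_index -fsbigT_const.
have -> : (\sum_(i \in [set: lattice_index M]) mu (cell 1))%E =
  (\sum_(i \in [set: lattice_index M]) mu [set cmul G (lat i) y | y in cell 1])%E.
  by apply: eq_fsbigr => i _; rewrite haar_cell_translate.
apply: content_sub_fsum.
- exact: finite_finset.
- by move=> kap _; exact: measurable_cell_translate.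
- exact: measurable_cell.
move=> w hw; have [x [a [xa ha hx]]] := cell_decomposition w k0.
have N1 : 1 <= N%:R :> R by rewrite ler1n.
(* The unknown x is the left factor, whereas [bdd_cmul_solve] bounds the right one; [cmulN] turns x
   a = w into (-a)(-x) = -w. *)
have hxb : bdd 1 (K * N%:R) x.
  rewrite -[x]opprK; apply: bddN; apply: (hK _ (- a)) => //.
    apply: bddN => i; apply: le_trans (cell_bbox ha i) _.
    by rewrite !mul1r expr1n exprn_ege1.
  by rewrite cmulN; apply: bddN; rewrite xa; exact: cell_bbox.
have DM i : (2 * D i < M ^ wt i)%N.
  rewrite /D /M -mulnA [((3 * _) ^ _)%N]expnMn.
  have D0 : (0 < (K0 * N) ^ wt i)%N by rewrite expn_gt0 muln_gt0 N0.
  rewrite ltn_pmul2r//; apply: leq_trans (_ : 3 ^ 1 <= _)%N => //.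
  by rewrite leq_exp2l.
have hz i : exists j : 'I_(M ^ wt i), x 0 i = 2 * (j%:R - (D i)%:R).
  have [z ez] := hx i.
  have zD : `|z%:~R| <= (D i)%:R :> R.
    have := hxb i; rewrite ez mul1r normrM => h.
    have : (K * N%:R) ^+ wt i <= (D i)%:R :> R.
      rewrite natrX natrM; apply: lerXn2r; rewrite ?nnegrE ?mulr_ge0//.
      - by rewrite (le_trans _ K1).
      - by rewrite ler_wpM2r.
    move=> /(le_trans _); apply; apply: le_trans h.
    by rewrite ger0_norm// ler_peMl// ler1n.
  have zD' : (`|z| <= D i)%R by rewrite -(ler_int R) intr_norm.
  pose j := absz (z + D i).
  have jM : (j < M ^ wt i)%N by have := DM i; rewrite /j; lia.
  exists (Ordinal jM); rewrite ez /=; congr (2 * _).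
  have -> : j%:R = (z + D i)%:~R :> R.
    by rewrite -[j%:R]/(j%:Z%:~R) /j gez0_abs//; lia.
  by rewrite intrD addrK.
exists [ffun i => sval (cid (hz i))] => //; exists a => //; rewrite -xa.
congr (cmul G _ a); apply/rowP => i; rewrite mxE ffunE.
by rewrite -(svalP (cid (hz i))).
Qed.

(** Small cells are packed, with M about 1/r, into one fixed compact box; large cells are covered,
    with N about r, by translates of the unit cell. Only invariance and finiteness on compact sets
    enter. *)
Lemma haar_bbox_le : (0 < hdim G)%N ->
  exists2 A : R, 0 <= A & forall r, 0 < r -> (mu (bbox 1 r) <= (A * r ^+ hdim G)%:E)%E.
Proof.
move=> Q0; have k0 := hdim_step Q0.
have bc r : 0 < r -> (mu (bbox 1 r) <= mu (cell (2 * r)))%E.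
  move=> r0; apply: le_measure; rewrite ?inE; [exact: measurable_bbox|exact: measurable_cell|].
  move=> x h i; have := h i; rewrite mul1r ler_norml exprMn => /andP[h1 h2].
  have c0 : 0 < r ^+ wt i by exact: exprn_gt0.
  have e2 : r ^+ wt i < 2 ^+ wt i * r ^+ wt i.
    by rewrite ltr_pMl// exprn_egt1// ltr1n.
  by rewrite (le_lt_trans h2 e2) andbT (le_trans _ h1)// lerN2 ltW.
have [C C1 hP] := packing k0; have [K hK] := covering k0.
have cell_fin r : mu (cell r) \is a fin_num.
  rewrite ge0_fin_numE//; apply: le_lt_trans (haar_bbox_fin 1 r).
  by apply: le_measure; rewrite ?inE;
    [exact: measurable_cell|exact: measurable_bbox|exact: cell_bbox].
(* For r <= 1 the choice of M gives 1 <= M r <= 2, so the packed cells lie in the box of size 2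
   C. *)
pose A1 := fine (mu (bbox 1 (C * 2))); pose A2 := (K * 2)%:R ^+ hdim G * fine (mu (cell 1)).
have A10 : 0 <= A1 by rewrite fine_ge0.
have A20 : 0 <= A2 by rewrite mulr_ge0 ?exprn_ge0// fine_ge0.
have A1E : mu (bbox 1 (C * 2)) = A1%:E.
  by rewrite fineK// ge0_fin_numE//; exact: haar_bbox_fin.
have small r : 0 < r -> r <= 1 -> (mu (cell r) <= (A1 * r ^+ hdim G)%:E)%E.
  move=> r0 r1; pose M := (Num.truncn r^-1).+1.
  have rM : 1 <= M%:R * r.
    by rewrite -ler_pdivrMr// mul1r ltW// truncnS_gt.
  have Mr : M%:R * r <= 2.
    have : (Num.truncn r^-1)%:R <= r^-1 by rewrite truncn_le invr_ge0 ltW.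
    rewrite /M -natr1 mulrDl mul1r => h.
    have : (Num.truncn r^-1)%:R * r <= 1 by rewrite -ler_pdivlMr// mul1r.
    by lra.
  have := hP M r isT r0.
  have : (mu (bbox 1 (C * (M%:R * r))) <= A1%:E)%E.
    rewrite -A1E; apply: le_measure; rewrite ?inE; try exact: measurable_bbox.
    move=> x h i; apply: le_trans (h i) _; rewrite !mul1r; apply: lerXn2r.
    - by rewrite nnegrE !mulr_ge0 ?(ltW r0)//; lra.
    - by rewrite nnegrE mulr_ge0//; lra.
    - by rewrite ler_wpM2l//; lra.
  move=> h1 h2; have := le_trans h2 h1.
  rewrite -[mu (cell r)]fineK// -EFinM !lee_fin natrX => h3.
  have m0 : 0 <= fine (mu (cell r)) by rewrite fine_ge0.
  apply: le_trans (_ : (M%:R * r) ^+ hdim G * fine (mu (cell r)) <= _).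
    by rewrite ler_peMl// exprn_ege1.
  by rewrite exprMn mulrAC ler_wpM2r// exprn_ge0// ltW.
have large r : 1 <= r -> (mu (cell r) <= (A2 * r ^+ hdim G)%:E)%E.
  move=> r1; have r0 : 0 <= r by rewrite (le_trans ler01).
  have [N [N0 rN Nr]] : exists N, [/\ (0 < N)%N, r <= N%:R & N%:R <= 2 * r].
    exists (Num.truncn r).+1; split => //; first by rewrite ltW// truncnS_gt.
    by rewrite -natr1 mulrDl mul1r lerD// truncn_le.
  have : (mu (cell r) <= mu (cell N%:R))%E.
    apply: le_measure; rewrite ?inE; try exact: measurable_cell.
    move=> x h i; have /andP[h1 h2] := h i.
    have e : r ^+ wt i <= N%:R ^+ wt i by apply: lerXn2r; rewrite ?nnegrE.
    by rewrite (lt_le_trans h2 e) (le_trans _ h1)// lerN2.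
  move=> /le_trans; apply; apply: (le_trans (hK N N0)).
  rewrite -[mu (cell 1)]fineK// -EFinM lee_fin /A2 mulrAC.
  rewrite ler_wpM2r ?fine_ge0// natrX -exprMn.
  apply: lerXn2r; rewrite ?nnegrE ?mulr_ge0//.
  by rewrite !natrM -mulrA ler_wpM2l.
exists ((A1 + A2) * 2 ^+ hdim G) => [|r r0].
  by rewrite mulr_ge0 ?exprn_ge0// addr_ge0.
have r20 : 0 < 2 * r by lra.
rewrite -mulrA -exprMn; apply: le_trans (bc r r0) _.
have rQ : 0 <= (2 * r) ^+ hdim G by rewrite exprn_ge0// ltW.
have [r1|r1] := leP (2 * r) 1.
  by apply: le_trans (small _ r20 r1) _; rewrite lee_fin ler_wpM2r// lerDl.
by apply: le_trans (large _ (ltW r1)) _; rewrite lee_fin ler_wpM2r// lerDr.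
Qed.

End HaarVolume.

(** * Power kernels *)

Lemma measurable_fun_powR d (T : measurableType d) (R : realType) (f : T -> R) p :
  measurable_fun [set: T] f -> measurable_fun [set: T] (fun t => f t `^ p).
Proof. by move=> mf; exact: (measurableT_comp (measurable_powR p) mf). Qed.

Section PowerKernels.
Context {R : realType}.
Implicit Types (Q gam rho : R).

Lemma powR_expR (x y : R) : 0 < x -> x `^ y = expR (y * ln x).
Proof. by move=> x0; rewrite /powR gt_eqF. Qed.

(* The powers of rho make the integrals of both kernels in x scale invariant;
   for rho = 0 both vanish unless gam = Q. *)
Definition kfar Q gam (x : R) rho : R :=
  if rho <= x then x `^ (- gam) * rho `^ (gam - Q) else 0.

Definition knear Q gam (x : R) rho : R :=
  if x <= rho then x `^ (- gam) * rho `^ (gam - Q) else 0.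

Lemma kfar_ge0 Q gam x rho : 0 <= kfar Q gam x rho.
Proof. by rewrite /kfar; case: ifP => // _; rewrite mulr_ge0 ?powR_ge0. Qed.

Lemma knear_ge0 Q gam x rho : 0 <= knear Q gam x rho.
Proof. by rewrite /knear; case: ifP => // _; rewrite mulr_ge0 ?powR_ge0. Qed.

Lemma measurable_kfar d (T : measurableType d) Q gam (f g : T -> R) :
  measurable_fun [set: T] f -> measurable_fun [set: T] g ->
  measurable_fun [set: T] (fun t => kfar Q gam (f t) (g t)).
Proof.
move=> mf mg; apply: measurable_fun_ifT => //; first exact: measurable_fun_ler.
by apply: measurable_funM; exact: measurable_fun_powR.
Qed.

Lemma measurable_knear d (T : measurableType d) Q gam (f g : T -> R) :
  measurable_fun [set: T] f -> measurable_fun [set: T] g ->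
  measurable_fun [set: T] (fun t => knear Q gam (f t) (g t)).
Proof.
move=> mf mg; apply: measurable_fun_ifT => //; first exact: measurable_fun_ler.
by apply: measurable_funM; exact: measurable_fun_powR.
Qed.

Lemma dyadic_shell (t : R) : 1 <= t ->
  exists k : nat, 2 `^ k%:R <= t /\ t < 2 `^ k.+1%:R.
Proof.
move=> t1; have t0 := le_trans ler01 t1.
have m0 : (0 < Num.truncn t)%N by rewrite truncn_gt0.
have /andP[h1 h2] := trunc_log_bounds (isT : (1 < 2)%N) m0.
exists (trunc_log 2 (Num.truncn t)); rewrite !powR_mulrn//; split.
  by apply: (@le_trans _ _ (Num.truncn t)%:R); rewrite -?natrX ?ler_nat ?truncn_le.
by apply: lt_le_trans (truncnS_gt t) _; rewrite -natrX ler_nat.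
Qed.

Section Integrals.
Context {d : measure_display} {T : measurableType d}.
Variable mu : {measure set T -> \bar R}.
Local Open Scope ereal_scope.

(** F is dominated by the series of the functions c_k 1_(S k). The sets may overlap, since at each
    point one term already suffices. *)
Lemma integral_layers (F : T -> R) (S : nat -> set T) (c m : nat -> R) (B : R) :
  measurable_fun [set: T] F -> (forall x, (0 <= F x)%R) ->
  (forall k, measurable (S k)) -> (forall k, (0 <= c k)%R) ->
  (forall x, (0 < F x)%R -> exists2 k, S k x & (F x <= c k)%R) ->
  (forall k, mu (S k) <= (m k)%:E) ->
  (forall N, (\sum_(0 <= k < N) c k * m k <= B)%R) ->
  \int[mu]_x (F x)%:E <= B%:E.
Proof.
move=> mF F0 mS c0 FS muS cB.
pose h k (x : T) := (c k * \1_(S k) x)%:E.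
have h0 k x : 0 <= h k x by rewrite lee_fin mulr_ge0.
have mh k : measurable_fun [set: T] (h k).
  by apply/measurable_EFinP; apply: measurable_funM.
apply: (@le_trans _ _ (\int[mu]_x (\sum_(0 <= k <oo) h k x))).
  apply: ge0_le_integral => //.
  - by move=> x _; rewrite lee_fin.
  - exact/measurable_EFinP.
  - by apply: ge0_emeasurable_sum => // k x _ _; exact: h0.
  - move=> x _; have [Fx|Fx] := ltP 0%R (F x); last first.
      by apply: le_trans (_ : 0 <= _); [rewrite lee_fin|apply: nneseries_ge0].
    have [k Sk Fk] := FS x Fx.
    apply: (@le_trans _ _ (\sum_(0 <= i < k.+1) h i x)).
      rewrite big_nat_recr //=; apply: (@le_trans _ _ (h k x)).
        by rewrite /h indicE mem_set// mulr1 lee_fin.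
      by rewrite leeDr// sume_ge0.
    by apply: nneseries_lim_ge => // i _ _; exact: h0.
rewrite integral_nneseries//.
apply: lime_le; first by apply: is_cvg_nneseries => k _ _; exact: integral_ge0.
apply: nearW => N; apply: (@le_trans _ _ (\sum_(0 <= k < N) (c k * m k)%:E)).
  apply: lee_sum => k _; rewrite /h.
  under eq_integral do rewrite EFinM.
  rewrite ge0_integralZl_EFin//; last first.
    by apply/measurable_EFinP; exact: measurable_indic.
  by rewrite integral_indic// setIT EFinM lee_wpmul2l// lee_fin.
by rewrite sumEFin lee_fin.
Qed.

Lemma geometric_bound (a q : R) N : (0 <= a)%R -> (0 < q)%R -> (q < 1)%R ->
  (\sum_(0 <= k < N) a * q ^+ k <= a / (1 - q))%R.
Proof.
move=> a0 q0 q1; have := @geometric_le_lim R N a q a0 q0.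
by rewrite ger0_norm ?(ltW q0)//; apply.
Qed.

(** The volume bound for balls; f will be N, D(u, .) or D(., v). *)
Definition upper_regular (A Q : R) (f : T -> R) :=
  forall rho, (0 < rho)%R -> mu [set x | (f x <= rho)%R] <= (A * rho `^ Q)%:E.

Lemma measurable_sublevel (f : T -> R) rho : measurable_fun [set: T] f ->
  measurable [set x | (f x <= rho)%R].
Proof.
move=> mf; rewrite -[X in measurable X]setTI.
have -> : [set x | (f x <= rho)%R] = f @^-1` `]-oo, rho]%classic.
  by apply/seteqP; split=> x; rewrite /= in_itv.
by apply: mf.
Qed.

(** The shell where f / rho lies between 2^k and 2^(k + 1) contributes at most A 2^Q 2^(k (Q -
    gam)). The powers of rho cancel, so one geometric series bounds the integral for all f and
    rho. *)
Lemma integral_kfar (A Q gam : R) : (0 <= A)%R -> (0 < Q)%R -> (Q < gam)%R ->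
  exists2 C : R, (0 <= C)%R & forall f : T -> R, measurable_fun [set: T] f ->
  upper_regular A Q f -> forall rho, (0 <= rho)%R ->
  \int[mu]_x (kfar Q gam (f x) rho)%:E <= C%:E.
Proof.
move=> A0 Q0 Qg; set q : R := (2 `^ (Q - gam))%R.
have ln2 : (0 < ln 2 :> R)%R by rewrite ln_gt0// ltr1n.
have q0 : (0 < q)%R by rewrite powR_gt0.
have q1 : (q < 1)%R.
  by rewrite /q powR_expR// -[X in (_ < X)%R]expR0 ltr_expR pmulr_llt0// subr_lt0.
pose a := (A * 2 `^ Q)%R.
have a0 : (0 <= a)%R by rewrite mulr_ge0// powR_ge0.
exists (a / (1 - q))%R => [|f mf regf rho].
  by rewrite divr_ge0// subr_ge0 ltW.
rewrite le_eqVlt => /predU1P[<-|rho0].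
  rewrite (eq_integral (fun=> 0)) ?integral0 ?lee_fin ?divr_ge0 ?subr_ge0 ?(ltW q1)//.
  move=> x _; rewrite /kfar; case: ifP => // _.
  by rewrite powR0 ?mulr0// subr_eq0 gt_eqF.
pose r k : R := (rho * 2 `^ k%:R)%R.
have r0 k : (0 < r k)%R by rewrite mulr_gt0// powR_gt0.
apply: (@integral_layers _ (fun k => [set x | (f x <= r k.+1)%R])
    (fun k => r k `^ (- gam) * rho `^ (gam - Q))%R
    (fun k => A * r k.+1 `^ Q)%R) => //.
- by apply: measurable_kfar.
- by move=> x; exact: kfar_ge0.
- by move=> k; exact: measurable_sublevel.
- by move=> k; rewrite mulr_ge0 ?powR_ge0.
- move=> x; rewrite /kfar; case: ifPn; last by rewrite ltxx.
  move=> rx _; have t1 : (1 <= f x / rho)%R by rewrite ler_pdivlMr// mul1r.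
  have [k []] := dyadic_shell t1; rewrite ler_pdivlMr// ltr_pdivrMr// => h1 h2.
  exists k; rewrite /= /r; first by rewrite mulrC ltW.
  rewrite ler_wpM2r ?powR_ge0//.
  have fx0 : (0 < f x)%R by exact: lt_le_trans rx.
  rewrite -/(r k) (powR_expR _ fx0) (powR_expR _ (r0 k)) ler_expR ler_wnM2l//.
    by rewrite oppr_le0 ltW// (lt_trans Q0).
  by rewrite ler_ln ?posrE// /r mulrC.
- by move=> k; exact: regf.
- move=> N; apply: le_trans (geometric_bound N a0 q0 q1).
  apply: ler_sum => k _.
  rewrite /a /q -[((2 `^ _) ^+ k)%R]powR_mulrn ?powR_ge0// -powRrM.
  rewrite mulrCA -2!mulrA ler_wpM2l//.
  rewrite !powR_expR// -!expRD /r !lnM ?posrE ?powR_gt0// !ln_powR -natr1.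
  by rewrite ler_expR; lra.
Qed.

Lemma integral_knear (A Q gam : R) : (0 <= A)%R -> (gam < Q)%R ->
  exists2 C : R, (0 <= C)%R & forall f : T -> R, measurable_fun [set: T] f ->
  (forall x, (0 <= f x)%R) ->
  upper_regular A Q f -> forall rho, (0 <= rho)%R ->
  \int[mu]_x (knear Q gam (f x) rho)%:E <= C%:E.
Proof.
move=> A0 Qg; set q : R := (2 `^ (gam - Q))%R.
have ln2 : (0 < ln 2 :> R)%R by rewrite ln_gt0// ltr1n.
have q0 : (0 < q)%R by rewrite powR_gt0.
have q1 : (q < 1)%R.
  by rewrite /q powR_expR// -[X in (_ < X)%R]expR0 ltr_expR pmulr_llt0// subr_lt0.
(* [gam] may be negative, and then x^(- gam) is largest at the outer end of a shell instead of the
   inner one; the factor 2^|gam| covers both signs. *)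
pose a := (A * 2 `^ `|gam|)%R.
have a0 : (0 <= a)%R by rewrite mulr_ge0// powR_ge0.
exists (a / (1 - q))%R => [|f mf f0 regf rho].
  by rewrite divr_ge0// subr_ge0 ltW.
rewrite le_eqVlt => /predU1P[<-|rho0].
  rewrite (eq_integral (fun=> 0)) ?integral0 ?lee_fin ?divr_ge0 ?subr_ge0 ?(ltW q1)//.
  move=> x _; rewrite /knear; case: ifP => // _.
  by rewrite [X in (_ * X)%R]powR0 ?mulr0// subr_eq0 lt_eqF.
pose r k : R := (rho * 2 `^ (- k%:R))%R.
have r0 k : (0 < r k)%R by rewrite mulr_gt0// powR_gt0.
apply: (@integral_layers _ (fun k => [set x | (f x <= r k)%R])
    (fun k => 2 `^ `|gam| * (r k `^ (- gam) * rho `^ (gam - Q)))%R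
    (fun k => A * r k `^ Q)%R) => //.
- by apply: measurable_knear.
- by move=> x; exact: knear_ge0.
- by move=> k; exact: measurable_sublevel.
- by move=> k; rewrite !mulr_ge0 ?powR_ge0.
- move=> x; rewrite /knear; case: ifPn => [xr|]; last by rewrite ltxx.
  (* At a zero of f the power is 0 by convention when [gam] is nonzero; for [gam] = 0 it is 1, and
     the kernel equals the bound of the layer 0. *)
  have [fx0 _|fx0 _] := ltP 0%R (f x); last first.
    have fx0' : f x = 0%R by apply/eqP; rewrite eq_le fx0 f0.
    exists 0%N; rewrite /= fx0'; first exact: ltW.
    have [->|g0] := eqVneq gam 0%R.
      by rewrite normr0 oppr0 !powRr0 !mul1r.
    by rewrite powR0 ?oppr_eq0// mul0r !mulr_ge0 ?powR_ge0.
  have t1 : (1 <= rho / f x)%R by rewrite ler_pdivlMr// mul1r.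
  have [k []] := dyadic_shell t1; rewrite ler_pdivlMr// ltr_pdivrMr// => h1 h2.
  have l1 : (k%:R * ln 2 + ln (f x) <= ln rho)%R.
    by rewrite -ln_powR -lnM ?posrE ?powR_gt0// ler_ln ?posrE// mulr_gt0 ?powR_gt0.
  have l2 : (ln rho <= k.+1%:R * ln 2 + ln (f x))%R.
    by rewrite -ln_powR -lnM ?posrE ?powR_gt0// ler_ln ?posrE ?ltW// mulr_gt0 ?powR_gt0.
  have lr : ln (r k) = (ln rho - k%:R * ln 2)%R.
    by rewrite /r lnM ?posrE ?powR_gt0// ln_powR mulNr.
  exists k; rewrite /=.
    by rewrite -ler_ln ?posrE// lr; lra.
  rewrite mulrA ler_wpM2r ?powR_ge0//.
  rewrite !powR_expR// -expRD ler_expR lr.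
  rewrite -natr1 mulrDl mul1r in l2.
  move: l1 l2; set u := (k%:R * ln 2)%R => l1 l2.
  have [g0|g0] := leP 0%R gam.
    by rewrite ger0_norm//; nra.
  by rewrite ltr0_norm//; nra.
- by move=> k; exact: regf.
- move=> N; apply: le_trans (geometric_bound N a0 q0 q1).
  apply: ler_sum => k _.
  rewrite /a /q -[((2 `^ _) ^+ k)%R]powR_mulrn ?powR_ge0// -powRrM.
  rewrite mulrCA -2!mulrA ler_wpM2l// ler_wpM2l ?powR_ge0//.
  rewrite !powR_expR// -!expRD /r !lnM ?posrE ?powR_gt0// !ln_powR.
  by rewrite ler_expR; lra.
Qed.

End Integrals.

End PowerKernels.

(** * The homogeneous norm *)

Section HomogeneousNorm.
Context {R : realType} (G : carnotGroup R).
Local Notation n := (\sum_(j < step G) ldim G j)%N.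
Local Notation V := 'rV[R]_n.
Local Notation k := (step G).
Local Notation wt := (@wt R G).

Lemma enormN m (z : 'rV[R]_m) : enorm (- z) = enorm z.
Proof. by congr Num.sqrt; apply: eq_bigr => i _; rewrite mxE sqrrN. Qed.

Lemma hnormN (u : V) : hnorm G (- u) = hnorm G u.
Proof.
have e j : enorm (submxrow (- u) j) = enorm (submxrow u j).
  rewrite -(enormN (submxrow u j)); congr enorm.
  by apply/rowP => i; rewrite !mxE.
by rewrite /hnorm; under eq_bigr do rewrite e.
Qed.

Lemma hnorm_ge0 (u : V) : 0 <= hnorm G u. Proof. exact: powR_ge0. Qed.

Let e : R := (2 * k`!)%:R.

Let e_gt0 : 0 < e. Proof. by rewrite ltr0n muln_gt0 fact_gt0. Qed.

(** Together with [hnorm_bdd] this makes the norm comparable to the least rho with [bdd 1 rho u], so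
    box estimates transfer to the norm. *)
Lemma bdd_hnorm (u : V) : bdd 1 (hnorm G u) u.
Proof.
move=> i; rewrite mul1r; set j := tagnat.sig1 i.
set S := \sum_(j < k) enorm (submxrow u j) `^ (e / j.+1%:R).
have S0 : 0 <= S by apply: sumr_ge0 => ? _; exact: powR_ge0.
apply: (@le_trans _ _ (enorm (submxrow u j))).
  rewrite -sqrtr_sqr /enorm; apply: ler_wsqrtr.
  rewrite (bigD1 (tagnat.sig2 i)) //= [X in X ^+ 2 + _]mxE tagnat.sig2K.
  by rewrite lerDl; apply: sumr_ge0 => ? _; exact: sqr_ge0.
have en0 : 0 <= enorm (submxrow u j) by exact: sqrtr_ge0.
have j0 : j.+1%:R != 0 :> R by rewrite pnatr_eq0.
have e0 := lt0r_neq0 e_gt0.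
have -> : enorm (submxrow u j) =
    (enorm (submxrow u j) `^ (e / j.+1%:R)) `^ (j.+1%:R / e).
  by rewrite -powRrM mulrA divfK// divff// powRr1.
have -> : hnorm G u ^+ wt i = S `^ (j.+1%:R / e).
  by rewrite -powR_mulrn ?hnorm_ge0// /hnorm -powRrM mulrC.
apply: ge0_ler_powR; rewrite ?nnegrE ?powR_ge0//.
  by rewrite divr_ge0// ltW.
rewrite /S (bigD1 j) //= lerDl.
by apply: sumr_ge0 => ? _; exact: powR_ge0.
Qed.

Lemma hnorm_bdd : exists2 C : R, 1 <= C & forall rho (u : V), 0 <= rho ->
  bdd 1 rho u -> hnorm G u <= C * rho.
Proof.
pose D := \sum_(j < k) (ldim G j).+1%:R `^ (e / j.+1%:R) : R.
have D0 : 0 <= D by apply: sumr_ge0 => ? _; exact: powR_ge0.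
exists (1 + D `^ e^-1) => [|rho u r0 hu]; first by rewrite lerDl powR_ge0.
have e0 := lt0r_neq0 e_gt0.
apply: (@le_trans _ _ (D `^ e^-1 * rho)); last by rewrite mulrDl mul1r lerDr.
have -> : D `^ e^-1 * rho = (D * rho `^ e) `^ e^-1.
  by rewrite powRM ?powR_ge0// -powRrM mulfV// powRr1.
apply: ge0_ler_powR; rewrite ?nnegrE ?mulr_ge0 ?powR_ge0 ?invr_ge0 ?(ltW e_gt0)//.
  by apply: sumr_ge0 => ? _; exact: powR_ge0.
rewrite /D mulr_suml; apply: ler_sum => j _.
have j0 : j.+1%:R != 0 :> R by rewrite pnatr_eq0.
have -> : rho `^ e = (rho ^+ j.+1) `^ (e / j.+1%:R).
  by rewrite -powR_mulrn// -powRrM mulrC divfK.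
rewrite -powRM ?exprn_ge0//.
apply: ge0_ler_powR; rewrite ?nnegrE ?mulr_ge0 ?exprn_ge0 ?sqrtr_ge0//.
have c0 : 0 <= (ldim G j).+1%:R * rho ^+ j.+1 :> R by rewrite mulr_ge0 ?exprn_ge0.
rewrite -[leRHS](ger0_norm c0) -sqrtr_sqr; apply: ler_wsqrtr.
apply: (@le_trans _ _ (\sum_(i < ldim G j) (rho ^+ j.+1) ^+ 2)).
  apply: ler_sum => i _; rewrite -[leLHS]real_normK ?num_real//.
  apply: lerXn2r; rewrite ?nnegrE ?exprn_ge0//.
  by have := hu (tagnat.Rank j i); rewrite mul1r mxE /wt tagnat.Rank1K.
rewrite sumr_const card_ord -[leLHS]mulr_natl exprMn ler_wpM2r ?sqr_ge0//.
by rewrite -natrX ler_nat (leq_trans (leqnSn _))// -{1}[_.+1]expn1 leq_pexp2l.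
Qed.

Lemma measurable_hnorm d (T : measurableType d) (f : T -> V) : cmf f ->
  measurable_fun [set: T] (fun t => hnorm G (f t)).
Proof.
move=> hf; apply: measurable_fun_powR.
apply: measurable_sum => j; apply: measurable_fun_powR.
apply: (@measurableT_comp _ _ _ _ _ _ (@Num.sqrt R)).
  by apply: continuous_measurable_fun; exact: sqrt_continuous.
apply: measurable_sum => i.
under eq_fun do rewrite mxE.
exact: measurable_funX.
Qed.

Definition cdist (u v : V) := hnorm G (cmul G (cinv G u) v).

Lemma cdist_ge0 u v : 0 <= cdist u v. Proof. exact: hnorm_ge0. Qed.

(** (-u) v = - ((-v) u), and the norm is even. *)
Lemma cdistC u v : cdist u v = cdist v u.
Proof.
by rewrite /cdist /cinv -[in LHS](opprK v) -[v in - - v]opprK opprK cmulN hnormN.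
Qed.

(** The bound for v comes from solving (-u) v = z for v with [bdd_cmul_solve]; the bound for u is
    its mirror image under [cdistC]; the bound for the distance is that of a product. *)
Lemma cdist_quasi_triangle : (0 < k)%N -> exists2 C : R, 1 <= C & forall u v : V,
  [/\ hnorm G v <= C * (hnorm G u + cdist u v),
      hnorm G u <= C * (hnorm G v + cdist u v) &
      cdist u v <= C * (hnorm G u + hnorm G v)].
Proof.
move=> k0; have [C C1 hC] := hnorm_bdd.
have [M M1 hM] := bdd_cmul k0; have [K K1 hK] := bdd_cmul_solve k0.
have C0 := le_trans ler01 C1; have M0 := le_trans ler01 M1.
have K0 := le_trans ler01 K1.
have bddS rho rho' (x : V) : 0 <= rho -> rho <= rho' -> bdd 1 rho x -> bdd 1 rho' x.
  move=> r0 rr h i; apply: le_trans (h i) _; rewrite !mul1r.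
  by apply: lerXn2r; rewrite ?nnegrE// (le_trans r0).
have tri u v : hnorm G v <= C * K * (hnorm G u + cdist u v).
  have s0 : 0 <= hnorm G u + cdist u v by rewrite addr_ge0 ?hnorm_ge0 ?cdist_ge0.
  rewrite -mulrA; apply: hC; first by rewrite mulr_ge0.
  apply: (hK _ (cinv G u)) => //.
    apply: (bddS (hnorm G u)); rewrite ?hnorm_ge0 ?lerDl ?cdist_ge0//.
    by apply: bddN; exact: bdd_hnorm.
  apply: (bddS (cdist u v)); rewrite ?hnorm_ge0 ?lerDr ?hnorm_ge0//.
  exact: bdd_hnorm.
have le1 x s : 0 <= s -> x <= C * K * s -> x <= C * (K * M) * s.
  move=> s0 /le_trans; apply; rewrite ler_wpM2r// mulrA ler_peMr// mulr_ge0//.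
exists (C * (K * M)) => [|u v]; first by rewrite !mulr_ege1.
split.
- by apply: le1 => //; rewrite addr_ge0 ?hnorm_ge0 ?cdist_ge0.
- by apply: le1; rewrite ?addr_ge0 ?hnorm_ge0 ?cdist_ge0// cdistC.
have s0 : 0 <= hnorm G u + hnorm G v by rewrite addr_ge0 ?hnorm_ge0.
apply: (@le_trans _ _ (C * (M * (hnorm G u + hnorm G v)))); last first.
  by rewrite -!mulrA ler_wpM2l// ler_peMl// mulr_ge0.
apply: hC; first by rewrite mulr_ge0.
apply: hM => //.
  apply: (bddS (hnorm G u)); rewrite ?hnorm_ge0 ?lerDl ?hnorm_ge0//.
  by apply: bddN; exact: bdd_hnorm.
by apply: (bddS (hnorm G v)); rewrite ?hnorm_ge0 ?lerDr ?hnorm_ge0//; exact: bdd_hnorm.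
Qed.

Lemma measurable_hnorm_id : measurable_fun [set: carnot G] (hnorm G : carnot G -> R).
Proof. exact: (measurable_hnorm (@cmf_id R G)). Qed.

Lemma measurable_cdist : (0 < k)%N ->
  measurable_fun [set: carnot G * carnot G]
    (fun uv : carnot G * carnot G => cdist uv.1 uv.2).
Proof.
move=> k0; apply: measurable_hnorm; apply: cmf_cmul => //.
  apply: cmfN => i; apply: (measurableT_comp (cmf_id _)).
  exact: measurable_fst.
by move=> i; apply: (measurableT_comp (cmf_id _)); exact: measurable_snd.
Qed.

Lemma haar_ball_le (mu : {measure set (carnot G) -> \bar R}) :
  is_haar G mu -> (0 < hdim G)%N -> exists2 A : R, 0 <= A & forall rho : R, 0 < rho ->
  (mu [set u : carnot G | (hnorm G u <= rho)%R] <= (A * rho ^+ hdim G)%:E)%E /\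
  forall u, (mu [set v : carnot G | (cdist u v <= rho)%R] <= (A * rho ^+ hdim G)%:E)%E.
Proof.
move=> hmu Q0; have k0 := hdim_step Q0.
have [A A0 hA] := haar_bbox_le hmu Q0; exists A => // rho r0.
have mB : measurable [set u : carnot G | hnorm G u <= rho].
  rewrite -[X in measurable X]setTI.
  have -> : [set u : carnot G | hnorm G u <= rho] = hnorm G @^-1` `]-oo, rho]%classic.
    by apply/seteqP; split=> x; rewrite /= in_itv.
  by apply: measurable_hnorm_id.
have ball : (mu [set u : carnot G | (hnorm G u <= rho)%R] <= (A * rho ^+ hdim G)%:E)%E.
  apply: le_trans (hA _ r0); apply: le_measure; rewrite ?inE//.
    exact: measurable_bbox.
  move=> x /= xr i; apply: le_trans (bdd_hnorm x i) _; rewrite !mul1r.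
  by apply: lerXn2r; rewrite ?nnegrE ?hnorm_ge0// ltW.
split=> [|u]; first exact: ball.
case: hmu => hinv _ _.
pose B : set (carnot G) := [set v : carnot G | cdist u v <= rho].
have mBu : measurable B.
  rewrite -[X in measurable X]setTI.
  have -> : B = (fun v : carnot G => cdist u v) @^-1` `]-oo, rho]%classic.
    by apply/seteqP; split=> x; rewrite /= in_itv.
  have : measurable_fun [set: carnot G] (fun v : carnot G => cdist u v).
    apply: measurable_hnorm; apply: cmf_cmul => //; last exact: cmf_id.
  by apply.
(* Left translation by -u carries the ball about u onto the ball about 0; [linv] provides the
   surjectivity. *)
have BE : [set cmul G (cinv G u) y | y in B] = [set w : V | hnorm G w <= rho].
  apply/seteqP; split=> [_ [y yB <-] //|z zr]; exists (linv (cinv G u) z).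
    by rewrite /B /= /cdist cmul_linv.
  exact: cmul_linv.
have := hinv (cinv G u) B mBu; rewrite BE => eB.
have : (mu B <= (A * rho ^+ hdim G)%:E)%E by rewrite -eB; exact: ball.
exact.
Qed.

End HomogeneousNorm.

(** * Bilinear forms bounded by Tonelli *)

Section ControlledForms.
Context {R : realType} {d : measure_display} {T : measurableType d}.
Variable mu : {sigma_finite_measure set T -> \bar R}.
Variables (A Q : R) (N : T -> R) (D : T * T -> R).
Hypotheses (A0 : 0 <= A) (Q0 : 0 < Q).
Hypotheses (mN : measurable_fun [set: T] N) (N0 : forall u, 0 <= N u).
Hypotheses (mD : measurable_fun [set: T * T] D) (D0 : forall p, 0 <= D p).
Hypothesis regN : upper_regular mu A Q N.
Hypothesis regDl : forall u, upper_regular mu A Q (fun v => D (u, v)).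
Hypothesis regDr : forall v, upper_regular mu A Q (fun u => D (u, v)).
Local Open Scope ereal_scope.

Let diag (w : R -> R -> R -> R -> R -> R) (a b : T -> R) (p : T * T) : R :=
  w (a p.1) (b p.2) (N p.1) (N p.2) (D p).

Definition unit_density (a : T -> R) :=
  [/\ measurable_fun [set: T] a, forall x, (0 <= a x)%R &
      \int[mu]_x (a x)%:E <= 1].

(* The arguments of w stand for a(u), b(v), N(u), N(v) and D(u, v). *)
Definition controlled (w : R -> R -> R -> R -> R -> R) :=
  [/\ forall a b, measurable_fun [set: T] a -> measurable_fun [set: T] b ->
        measurable_fun [set: T * T] (diag w a b),
      forall a b n m t, (0 <= a)%R -> (0 <= b)%R -> (0 <= w a b n m t)%R &
      exists2 C : R, (0 <= C)%R & forall a b, unit_density a -> unit_density b ->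
        \int[mu \x mu]_p (diag w a b p)%:E <= C%:E].

Lemma controlledD w1 w2 : controlled w1 -> controlled w2 ->
  controlled (fun a b n m t => w1 a b n m t + w2 a b n m t)%R.
Proof.
move=> [m1 p1 [C1 C10 h1]] [m2 p2 [C2 C20 h2]]; split.
- by move=> a b ma mb; apply: measurable_funD; [exact: m1|exact: m2].
- by move=> *; rewrite addr_ge0 ?p1 ?p2.
exists (C1 + C2)%R; first exact: addr_ge0.
move=> a b ha hb; have [ma a0 _] := ha; have [mb b0 _] := hb.
under eq_integral do rewrite /diag EFinD.
rewrite ge0_integralD//.
- by rewrite EFinD leeD//; [exact: h1|exact: h2].
- by move=> p _; rewrite lee_fin p1.
- by apply/measurable_EFinP; exact: m1.
- by move=> p _; rewrite lee_fin p2.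
- by apply/measurable_EFinP; exact: m2.
Qed.

Lemma measurable_fst_comp (a : T -> R) : measurable_fun [set: T] a ->
  measurable_fun [set: T * T] (fun p : T * T => a p.1).
Proof. by move=> ma; apply: (measurableT_comp ma); exact: measurable_fst. Qed.

Lemma measurable_snd_comp (a : T -> R) : measurable_fun [set: T] a ->
  measurable_fun [set: T * T] (fun p : T * T => a p.2).
Proof. by move=> ma; apply: (measurableT_comp ma); exact: measurable_snd. Qed.

(** The integral in v is at most C for each u, and h has integral at most 1. *)
Lemma tonelli_left (h : T -> R) (k : T * T -> R) (C : R) :
  unit_density h -> measurable_fun [set: T * T] k -> (forall p, (0 <= k p)%R) ->
  (0 <= C)%R -> (forall u, \int[mu]_v (k (u, v))%:E <= C%:E) ->
  \int[mu \x mu]_p (h p.1 * k p)%:E <= C%:E.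
Proof.
move=> [mh h0 h1] mk k0 C0 hk.
have mf : measurable_fun [set: T * T] (fun p => (h p.1 * k p)%:E).
  by apply/measurable_EFinP; apply: measurable_funM => //; exact: measurable_fst_comp.
have f0 p : 0 <= (h p.1 * k p)%:E by rewrite lee_fin mulr_ge0.
rewrite (fubini_tonelli1 _ mf f0).
apply: (@le_trans _ _ (\int[mu]_u (C%:E * (h u)%:E))).
  apply: ge0_le_integral => //.
  - by move=> u _; apply: integral_ge0.
  - exact: measurable_fun_fubini_tonelli_F.
  - by apply/measurable_EFinP; exact: measurable_funM.
  move=> u _; rewrite /fubini_F /=; under eq_integral do rewrite EFinM.
  rewrite ge0_integralZl_EFin//; first by rewrite muleC lee_wpmul2r// lee_fin.
  - by move=> v _; rewrite lee_fin.
  - by apply/measurable_EFinP; exact: (measurableT_comp mk).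
rewrite ge0_integralZl_EFin//.
- by rewrite -[leRHS]mule1 lee_wpmul2l// lee_fin.
- by move=> u _; rewrite lee_fin.
- exact/measurable_EFinP.
Qed.

Lemma tonelli_right (h : T -> R) (k : T * T -> R) (C : R) :
  unit_density h -> measurable_fun [set: T * T] k -> (forall p, (0 <= k p)%R) ->
  (0 <= C)%R -> (forall v, \int[mu]_u (k (u, v))%:E <= C%:E) ->
  \int[mu \x mu]_p (h p.2 * k p)%:E <= C%:E.
Proof.
move=> [mh h0 h1] mk k0 C0 hk.
have mf : measurable_fun [set: T * T] (fun p => (h p.2 * k p)%:E).
  by apply/measurable_EFinP; apply: measurable_funM => //; exact: measurable_snd_comp.
have f0 p : 0 <= (h p.2 * k p)%:E by rewrite lee_fin mulr_ge0.
rewrite (fubini_tonelli2 _ mf f0).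
apply: (@le_trans _ _ (\int[mu]_v (C%:E * (h v)%:E))).
  apply: ge0_le_integral => //.
  - by move=> v _; apply: integral_ge0.
  - exact: measurable_fun_fubini_tonelli_G.
  - by apply/measurable_EFinP; exact: measurable_funM.
  move=> v _; rewrite /fubini_G /=; under eq_integral do rewrite EFinM.
  rewrite ge0_integralZl_EFin//; first by rewrite muleC lee_wpmul2r// lee_fin.
  - by move=> u _; rewrite lee_fin.
  - by apply/measurable_EFinP; exact: (measurableT_comp mk).
rewrite ge0_integralZl_EFin//.
- by rewrite -[leRHS]mule1 lee_wpmul2l// lee_fin.
- by move=> v _; rewrite lee_fin.
- exact/measurable_EFinP.
Qed.

Lemma controlled_prod : controlled (fun a b _ _ _ => a * b)%R.
Proof.
split=> [a b ma mb|a b n m t a0 b0|].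
- by apply: measurable_funM; [exact: measurable_fst_comp|exact: measurable_snd_comp].
- exact: mulr_ge0.
exists 1%R => // a b ha [mb b0 b1]; rewrite /diag.
apply: (tonelli_left (k := fun p => b p.2)) => //.
exact: measurable_snd_comp.
Qed.

Section Kernels.
Variables (X : R -> R -> R) (rho : R -> R -> R) (gam : R).
Hypothesis mX : forall m t : T * T -> R, measurable_fun [set: T * T] m ->
  measurable_fun [set: T * T] t -> measurable_fun [set: T * T] (fun p => X (m p) (t p)).
Hypothesis mrho : forall a n : T * T -> R, measurable_fun [set: T * T] a ->
  measurable_fun [set: T * T] n -> measurable_fun [set: T * T] (fun p => rho (a p) (n p)).
Hypothesis X0 : forall m t, (0 <= m)%R -> (0 <= t)%R -> (0 <= X m t)%R.
Hypothesis rho0 : forall a n, (0 <= a)%R -> (0 <= n)%R -> (0 <= rho a n)%R.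

(** [X] selects the variable of the kernel, N v or D(u, v). The cut-off [rho] depends on u alone,
    through a(u) and N u, so the integral in v is bounded uniformly in u and a. *)
Lemma controlled_left_far : (Q < gam)%R ->
  (forall u, upper_regular mu A Q (fun v => X (N v) (D (u, v)))) ->
  controlled (fun a b n m t => a * kfar Q gam (X m t) (rho a n))%R.
Proof.
move=> Qg regX; have [C C0 hC] := integral_kfar mu A0 Q0 Qg.
have mk a : measurable_fun [set: T] a -> measurable_fun [set: T * T]
    (fun p => kfar Q gam (X (N p.2) (D p)) (rho (a p.1) (N p.1))).
  move=> ma; apply: measurable_kfar.
    by apply: mX => //; exact: measurable_snd_comp.
  by apply: mrho; exact: measurable_fst_comp.
split=> [a b ma mb|a b n m t a0 b0|].
- by apply: measurable_funM; [exact: measurable_fst_comp|exact: mk].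
- by rewrite mulr_ge0// kfar_ge0.
exists C => // a b ha hb; have [ma a0 _] := ha; rewrite /diag.
apply: (tonelli_left (k := fun p => kfar Q gam (X (N p.2) (D p)) (rho (a p.1) (N p.1)))) => //.
- exact: mk.
- by move=> p; exact: kfar_ge0.
- move=> u /=; apply: (hC (fun v => X (N v) (D (u, v)))) => //; last exact: rho0.
  apply: (measurableT_comp (f := fun p => X (N p.2) (D p)) (g := fun v => (u, v)));
    last exact: pair1_measurable.
  by apply: mX => //; exact: measurable_snd_comp.
Qed.

Lemma controlled_left_near : (gam < Q)%R ->
  (forall u, upper_regular mu A Q (fun v => X (N v) (D (u, v)))) ->
  controlled (fun a b n m t => a * knear Q gam (X m t) (rho a n))%R.
Proof.
move=> Qg regX; have [C C0 hC] := integral_knear mu A0 Qg.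
have mk a : measurable_fun [set: T] a -> measurable_fun [set: T * T]
    (fun p => knear Q gam (X (N p.2) (D p)) (rho (a p.1) (N p.1))).
  move=> ma; apply: measurable_knear.
    by apply: mX => //; exact: measurable_snd_comp.
  by apply: mrho; exact: measurable_fst_comp.
split=> [a b ma mb|a b n m t a0 b0|].
- by apply: measurable_funM; [exact: measurable_fst_comp|exact: mk].
- by rewrite mulr_ge0// knear_ge0.
exists C => // a b ha hb; have [ma a0 _] := ha; rewrite /diag.
apply: (tonelli_left (k := fun p => knear Q gam (X (N p.2) (D p)) (rho (a p.1) (N p.1)))) => //.
- exact: mk.
- by move=> p; exact: knear_ge0.
- move=> u /=; apply: (hC (fun v => X (N v) (D (u, v)))) => //; last exact: rho0.
    apply: (measurableT_comp (f := fun p => X (N p.2) (D p)) (g := fun v => (u, v)));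
      last exact: pair1_measurable.
    by apply: mX => //; exact: measurable_snd_comp.
  by move=> v; exact: X0.
Qed.

Lemma controlled_right_far : (Q < gam)%R ->
  (forall v, upper_regular mu A Q (fun u => X (N u) (D (u, v)))) ->
  controlled (fun a b n m t => b * kfar Q gam (X n t) (rho b m))%R.
Proof.
move=> Qg regX; have [C C0 hC] := integral_kfar mu A0 Q0 Qg.
have mk a : measurable_fun [set: T] a -> measurable_fun [set: T * T]
    (fun p => kfar Q gam (X (N p.1) (D p)) (rho (a p.2) (N p.2))).
  move=> ma; apply: measurable_kfar.
    by apply: mX => //; exact: measurable_fst_comp.
  by apply: mrho; exact: measurable_snd_comp.
split=> [a b ma mb|a b n m t a0 b0|].
- by apply: measurable_funM; [exact: measurable_snd_comp|exact: mk].
- by rewrite mulr_ge0// kfar_ge0.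
exists C => // a b ha hb; have [mb b0 _] := hb; rewrite /diag.
apply: (tonelli_right (k := fun p => kfar Q gam (X (N p.1) (D p)) (rho (b p.2) (N p.2)))) => //.
- exact: mk.
- by move=> p; exact: kfar_ge0.
- move=> v /=; apply: (hC (fun u => X (N u) (D (u, v)))) => //; last exact: rho0.
  apply: (measurableT_comp (f := fun p => X (N p.1) (D p)) (g := fun u => (u, v)));
    last exact: pair2_measurable.
  by apply: mX => //; exact: measurable_fst_comp.
Qed.

Lemma controlled_right_near : (gam < Q)%R ->
  (forall v, upper_regular mu A Q (fun u => X (N u) (D (u, v)))) ->
  controlled (fun a b n m t => b * knear Q gam (X n t) (rho b m))%R.
Proof.
move=> Qg regX; have [C C0 hC] := integral_knear mu A0 Qg.
have mk a : measurable_fun [set: T] a -> measurable_fun [set: T * T]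
    (fun p => knear Q gam (X (N p.1) (D p)) (rho (a p.2) (N p.2))).
  move=> ma; apply: measurable_knear.
    by apply: mX => //; exact: measurable_fst_comp.
  by apply: mrho; exact: measurable_snd_comp.
split=> [a b ma mb|a b n m t a0 b0|].
- by apply: measurable_funM; [exact: measurable_snd_comp|exact: mk].
- by rewrite mulr_ge0// knear_ge0.
exists C => // a b ha hb; have [mb b0 _] := hb; rewrite /diag.
apply: (tonelli_right (k := fun p => knear Q gam (X (N p.1) (D p)) (rho (b p.2) (N p.2)))) => //.
- exact: mk.
- by move=> p; exact: knear_ge0.
- move=> v /=; apply: (hC (fun u => X (N u) (D (u, v)))) => //; last exact: rho0.
    apply: (measurableT_comp (f := fun p => X (N p.1) (D p)) (g := fun u => (u, v)));
      last exact: pair2_measurable.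
    by apply: mX => //; exact: measurable_fst_comp.
  by move=> u; exact: X0.
Qed.

End Kernels.

End ControlledForms.

(** * Pointwise bounds for the Stein-Weiss kernel *)

Section PointwiseBounds.
Context {R : realType}.
Implicit Types (a b n m t : R).

(** A weighted mean is at most the maximum, and the largest of the three exponentials is at most
    their sum. *)
Lemma expR_mean3 (x y z w1 w2 w3 : R) : 0 <= w1 -> 0 <= w2 -> 0 <= w3 ->
  w1 + w2 + w3 = 1 ->
  expR (w1 * x + w2 * y + w3 * z) <= expR x + expR y + expR z.
Proof.
move=> w10 w20 w30 w1E.
have ex := expR_gt0 x; have ey := expR_gt0 y; have ez := expR_gt0 z.
pose M := Num.max x (Num.max y z).
have xM : x <= M by rewrite le_max lexx.
have yM : y <= M by rewrite !le_max lexx orbT.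
have zM : z <= M by rewrite !le_max lexx !orbT.
have h : w1 * x + w2 * y + w3 * z <= M.
  have -> : M = w1 * M + w2 * M + w3 * M by rewrite -!mulrDl w1E mul1r.
  by rewrite !lerD// ler_wpM2l.
apply: (@le_trans _ _ (expR M)); first by rewrite ler_expR.
rewrite /M; have [_|_] := ltP x (Num.max y z); last by rewrite -addrA lerDl addr_ge0 ?ltW.
have [_|_] := ltP y z; first by rewrite lerDr addr_ge0 ?ltW.
by rewrite addrAC lerDr addr_ge0 ?ltW.
Qed.

Lemma expR_mean2 (x y w1 w2 : R) : 0 <= w1 -> 0 <= w2 -> w1 + w2 = 1 ->
  expR (w1 * x + w2 * y) <= expR x + expR y.
Proof.
move=> w10 w20 w1E; have ex := expR_gt0 x; have ey := expR_gt0 y.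
have [xy|/ltW yx] := leP x y.
  apply: (@le_trans _ _ (expR y)); last by rewrite lerDr ltW.
  by rewrite ler_expR -[leRHS]mul1r -w1E mulrDl lerD2r ler_wpM2l.
apply: (@le_trans _ _ (expR x)); last by rewrite lerDl ltW.
by rewrite ler_expR -[leRHS]mul1r -w1E mulrDl lerD2l ler_wpM2l.
Qed.

(** p1 and p2 stand for 1/r and 1/s. Through the balance equation, 1 <= p1 + p2 is the condition
    lambda + alpha + beta <= Q. *)
Record admissible (Q p1 p2 alpha beta lambda : R) : Prop := Admissible {
  adm_Q : 0 < Q ; adm_p1 : 0 < p1 < 1 ; adm_p2 : 0 < p2 < 1 ;
  adm_p12 : 1 <= p1 + p2 ; adm_lambda : 0 < lambda ;
  adm_bal : lambda + alpha + beta = Q * (2 - p1 - p2) }.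

Lemma admissible_sym Q p1 p2 alpha beta lambda :
  admissible Q p1 p2 alpha beta lambda -> admissible Q p2 p1 beta alpha lambda.
Proof. by case=> *; split => //; lra. Qed.

Definition sw_form (p1 p2 alpha beta lambda a b n m t : R) : R :=
  a `^ p1 * b `^ p2 * (n `^ alpha * t `^ lambda * m `^ beta)^-1.

Lemma sw_form_sym p1 p2 alpha beta lambda a b n m t :
  sw_form p2 p1 beta alpha lambda b a m n t = sw_form p1 p2 alpha beta lambda a b n m t.
Proof.
rewrite /sw_form [b `^ _ * _]mulrC mulrAC [m `^ _ * _ * _]mulrC mulrA mulrAC.
by congr (_ / _); rewrite [RHS]mulrAC mulrC mulrA.
Qed.

Definition quasi_triangle (K n m t : R) :=
  [/\ m <= K * (n + t), n <= K * (m + t) & t <= K * (n + m)].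

Lemma quasi_triangle_sym K n m t : quasi_triangle K n m t -> quasi_triangle K m n t.
Proof. by case=> *; split => //; rewrite [m + n]addrC. Qed.

Section Form.
Variables (p1 p2 alpha beta lambda : R).
Local Notation sw_form := (sw_form p1 p2 alpha beta lambda).

Lemma sw_form_ge0 a b n m t : 0 <= sw_form a b n m t.
Proof. by rewrite /sw_form mulr_ge0 ?invr_ge0 ?mulr_ge0 ?powR_ge0. Qed.

Lemma sw_formE a b n m t : 0 < a -> 0 < b -> 0 < n -> 0 < m -> 0 < t ->
  sw_form a b n m t =
  expR (p1 * ln a + p2 * ln b - alpha * ln n - lambda * ln t - beta * ln m).
Proof.
move=> *; rewrite /sw_form !powR_expR// -!expRD -expRN -expRD; congr expR; lra.
Qed.

Lemma sw_form_eq0 a b n m t : 0 < p1 -> 0 < p2 -> 0 < lambda ->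
  (a == 0) || (b == 0) || (t == 0) -> sw_form a b n m t = 0.
Proof.
move=> p10 p20 l0 /orP[/orP[]|] /eqP ->; rewrite /sw_form.
- by rewrite powR0 ?mul0r// gt_eqF.
- by rewrite [0 `^ p2]powR0 ?mulr0 ?mul0r// gt_eqF.
- by rewrite [0 `^ lambda]powR0 ?gt_eqF// mulr0 mul0r invr0 mulr0.
Qed.

End Form.

Lemma kfarE Q gam (x rho : R) : 0 < rho -> rho <= x ->
  kfar Q gam x rho = expR (- gam * ln x + (gam - Q) * ln rho).
Proof.
by move=> r0 rx; rewrite /kfar rx !powR_expR ?(lt_le_trans r0)// expRD.
Qed.

Lemma knearE Q gam (x rho : R) : 0 < x -> x <= rho ->
  knear Q gam x rho = expR (- gam * ln x + (gam - Q) * ln rho).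
Proof.
by move=> x0 rx; rewrite /knear rx !powR_expR ?(lt_le_trans x0)// expRD.
Qed.

(* If m dominates n then t is comparable to m and the kernel is of Hardy type. *)
Lemma sw_form_hardy Q p1 p2 alpha beta lambda K e a b n m t :
  admissible Q p1 p2 alpha beta lambda -> 1 <= K ->
  0 < a -> 0 < b -> 0 < n -> 0 < m -> 0 < t ->
  quasi_triangle K n m t -> 2 * K * n <= m ->
  e * (2 - p1 - p2) = Q * (1 - p1) - alpha ->
  sw_form p1 p2 alpha beta lambda a b n m t <= expR (lambda * ln (2 * K)) *
    (a * kfar Q (Q + e) m n + b * knear Q (Q - e) n m + a * b).
Proof.
case=> Q0 /andP[p10 p11] /andP[p20 p21] p12 l0 bal K1 a0 b0 n0 m0 t0 [h1 _ _] nm eE.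
have K0 : 0 < K by lra.
(* In m <= K (n + t) the term K n is at most m / 2 and is absorbed. *)
have mt : m <= 2 * K * t by nra.
have nm' : n <= m.
  by apply: le_trans nm; rewrite ler_peMl ?(ltW n0)//; lra.
rewrite sw_formE// kfarE// knearE//.
have -> : a * b = expR (ln a + ln b) by rewrite expRD !lnK.
rewrite -{2}[a](lnK a0) -{2}[b](lnK b0) -!expRD.
have tl : ln m <= ln (2 * K) + ln t.
  by rewrite -lnM ?posrE ?mulr_gt0// ler_ln ?posrE// !mulr_gt0.
move: tl; set x1 := ln a; set y1 := ln b; set ln_n := ln n; set lm := ln m.
set lt := ln t; set L := ln (2 * K) => tl.
have s0 : 0 < 2 - p1 - p2 by lra.
have betaE : beta = Q * (2 - p1 - p2) - lambda - alpha by lra.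
have alphaE : alpha = Q * (1 - p1) - e * (2 - p1 - p2) by lra.
have ltl : lambda * lm <= lambda * (L + lt) by rewrite ler_wpM2l// ltW.
(* The weights give a and b the exponents p1 and p2; e was chosen to give n the exponent - alpha,
   and the balance equation leaves - lambda - beta for m, of which the part - lambda is moved to t
   by [tl]. *)
apply: (@le_trans _ _ (expR (lambda * L) * expR (
  (1 - p2) * (x1 + (- (Q + e) * lm + (Q + e - Q) * ln_n)) +
  (1 - p1) * (y1 + (- (Q - e) * ln_n + (Q - e - Q) * lm)) +
  (p1 + p2 - 1) * (x1 + y1)))).
  rewrite -expRD ler_expR -subr_ge0.
  suff -> : lambda * L + ((1 - p2) * (x1 + (- (Q + e) * lm + (Q + e - Q) * ln_n)) +
     (1 - p1) * (y1 + (- (Q - e) * ln_n + (Q - e - Q) * lm)) +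
     (p1 + p2 - 1) * (x1 + y1)) -
    (p1 * x1 + p2 * y1 - alpha * ln_n - lambda * lt - beta * lm) =
    lambda * (L + lt) - lambda * lm by lra.
  by rewrite betaE alphaE; ring.
by rewrite ler_wpM2l ?expR_ge0//; apply: expR_mean3; lra.
Qed.

Let ln_near (K n m : R) : 1 <= K -> 0 < n -> 0 < m ->
  m <= 2 * K * n -> n <= 2 * K * m -> `|ln n - ln m| <= ln (2 * K).
Proof.
move=> K1 n0 m0 mn nm; have K0 : 0 < 2 * K by lra.
have h1 : ln m <= ln (2 * K) + ln n.
  by rewrite -lnM ?posrE// ler_ln ?posrE// mulr_gt0.
have h2 : ln n <= ln (2 * K) + ln m.
  by rewrite -lnM ?posrE// ler_ln ?posrE// mulr_gt0.
by rewrite ler_norml; apply/andP; split; lra.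
Qed.

(** Here t is at most K (1 + 2 K) times either of n and m, so both near kernels are active. The
    value of [gam] gives t the exponent - lambda. The powers of n and m then match up to a factor (n
    / m)^c, which is bounded because n and m are comparable, and the powers of K (1 + 2 K) account
    for the other constant. *)
Lemma sw_form_comparable Q p1 p2 alpha beta lambda K gam a b n m t :
  admissible Q p1 p2 alpha beta lambda -> 1 <= K ->
  0 < a -> 0 < b -> 0 < n -> 0 < m -> 0 < t ->
  quasi_triangle K n m t -> m <= 2 * K * n -> n <= 2 * K * m ->
  gam * (2 - p1 - p2) = lambda ->
  sw_form p1 p2 alpha beta lambda a b n m t <=
    expR (`|(Q - gam) * (1 - p2) - alpha| * ln (2 * K) +
          (alpha + beta) * ln (K * (1 + 2 * K))) *
    (a * knear Q gam t (K * (1 + 2 * K) * n) +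
     b * knear Q gam t (K * (1 + 2 * K) * m) + a * b).
Proof.
case=> Q0 /andP[p10 p11] /andP[p20 p21] p12 l0 bal K1 a0 b0 n0 m0 t0 [_ _ h1] mn nm gE.
have K0 : 0 < K by lra.
set K3 := K * (1 + 2 * K); have K30 : 0 < K3 by rewrite mulr_gt0//; lra.
have tn : t <= K3 * n.
  by apply: le_trans h1 _; rewrite /K3 -mulrA ler_wpM2l ?(ltW K0)//; lra.
have tm : t <= K3 * m.
  by apply: le_trans h1 _; rewrite /K3 -mulrA ler_wpM2l ?(ltW K0)//; lra.
have nml := ln_near K1 n0 m0 mn nm.
have lK3 x : 0 < x -> ln (K3 * x) = ln K3 + ln x by move=> x0; rewrite lnM ?posrE.
rewrite sw_formE// !knearE// !lK3//.
have -> : a * b = expR (ln a + ln b) by rewrite expRD !lnK.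
rewrite -{2}[a](lnK a0) -{2}[b](lnK b0) -!expRD.
move: nml; set x1 := ln a; set y1 := ln b; set ln_n := ln n; set lm := ln m.
set lt := ln t; set L := ln (2 * K); set l3 := ln K3 => nml.
set c := (Q - gam) * (1 - p2) - alpha.
have cL : c * (ln_n - lm) <= `|c| * L.
  by apply: le_trans (ler_norm _) _; rewrite normrM ler_wpM2l.
apply: (@le_trans _ _ (expR (`|c| * L + (alpha + beta) * l3) * expR (
  (1 - p2) * (x1 + (- gam * lt + (gam - Q) * (l3 + ln_n))) +
  (1 - p1) * (y1 + (- gam * lt + (gam - Q) * (l3 + lm))) +
  (p1 + p2 - 1) * (x1 + y1)))).
  rewrite -expRD ler_expR -subr_ge0.
  suff -> : `|c| * L + (alpha + beta) * l3 +
    ((1 - p2) * (x1 + (- gam * lt + (gam - Q) * (l3 + ln_n))) +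
     (1 - p1) * (y1 + (- gam * lt + (gam - Q) * (l3 + lm))) +
     (p1 + p2 - 1) * (x1 + y1)) -
    (p1 * x1 + p2 * y1 - alpha * ln_n - lambda * lt - beta * lm) =
    `|c| * L - c * (ln_n - lm) by lra.
  have -> : beta = Q * (2 - p1 - p2) - lambda - alpha by lra.
  by rewrite /c -gE; ring.
by rewrite ler_wpM2l ?expR_ge0//; apply: expR_mean3; lra.
Qed.

(** As beta = - alpha and n, m are comparable, the weights are bounded and a^p1 b^p2 t^(- lambda)
    remains, with lambda = Q (2 - p1 - p2). If t >= a^(-1/Q), this is a geometric mean of a [kfar]
    and a b, where [x1] is tuned to give a the exponent p1; likewise for b. If t is below both
    cut-offs, the smaller of a and b is replaced by the larger, say a, and a [knear] is exactly
    a^(p1 + p2) t^(- lambda). *)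
Lemma sw_form_hls Q p1 p2 alpha beta lambda K x1 x2 a b n m t :
  admissible Q p1 p2 alpha beta lambda -> 1 <= K -> alpha + beta = 0 ->
  0 < a -> 0 < b -> 0 < n -> 0 < m -> 0 < t ->
  m <= 2 * K * n -> n <= 2 * K * m ->
  x1 * (1 - p2) = Q * (1 - p1) -> x2 * (1 - p1) = Q * (1 - p2) ->
  sw_form p1 p2 alpha beta lambda a b n m t <= expR (`|alpha| * ln (2 * K)) *
    (a * kfar Q (Q + x1) t (a `^ (- Q^-1)) + a * knear Q lambda t (a `^ (- Q^-1)) +
     (b * kfar Q (Q + x2) t (b `^ (- Q^-1)) + b * knear Q lambda t (b `^ (- Q^-1))) +
     a * b).
Proof.
case=> Q0 /andP[p10 p11] /andP[p20 p21] p12 l0 bal K1 ab0 a0 b0 n0 m0 t0 mn nm x1E x2E.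
have lamE : lambda = Q * (2 - p1 - p2) by lra.
have lamE' : lambda = Q * (2 - p2 - p1) by lra.
have nml := ln_near K1 n0 m0 mn nm.
have lnr c : 0 < c -> ln (c `^ (- Q^-1)) = - (ln c / Q).
  by move=> c0; rewrite ln_powR mulNr mulrC.
have lnQ c : ln c = Q * (ln c / Q) by rewrite mulrCA mulfV ?mulr1// gt_eqF.
rewrite sw_formE//.
have aL : - alpha * (ln n - ln m) <= `|alpha| * ln (2 * K).
  by apply: le_trans (ler_norm _) _; rewrite normrM normrN ler_wpM2l.
apply: (@le_trans _ _ (expR (`|alpha| * ln (2 * K)) *
    expR (p1 * ln a + p2 * ln b - lambda * ln t))).
  rewrite -expRD ler_expR; have -> : beta = - alpha by lra.
  by lra.
rewrite ler_wpM2l ?expR_ge0//.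
have ka g c : 0 <= c -> 0 <= c * kfar Q g t (c `^ (- Q^-1)).
  by move=> c0; rewrite mulr_ge0// kfar_ge0.
have kn g c : 0 <= c -> 0 <= c * knear Q g t (c `^ (- Q^-1)).
  by move=> c0; rewrite mulr_ge0// knear_ge0.
have ka1 := ka (Q + x1) _ (ltW a0); have ka2 := ka (Q + x2) _ (ltW b0).
have kn1 := kn lambda _ (ltW a0); have kn2 := kn lambda _ (ltW b0).
have ab : 0 <= a * b by rewrite mulr_ge0 ?ltW.
have far c c' q q' x : 0 < c -> 0 < c' -> 0 < q -> q < 1 -> 0 < q' -> q' < 1 ->
    x * (1 - q') = Q * (1 - q) -> lambda = Q * (2 - q - q') ->
    c `^ (- Q^-1) <= t ->
    expR (q * ln c + q' * ln c' - lambda * ln t) <=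
    c * kfar Q (Q + x) t (c `^ (- Q^-1)) + c * c'.
  move=> c0 c'0 q0 q1 q'0 q'1 xE lE ct.
  rewrite kfarE// ?powR_gt0// lnr//.
  have -> : c * c' = expR (ln c + ln c') by rewrite expRD !lnK.
  rewrite -{2}[c](lnK c0) -expRD.
  move: (lnQ c); set c1 := ln c / Q => ->.
  set Y := ln c'; set lt := ln t; set X := Q * c1 + _.
  have -> : q * (Q * c1) + q' * Y - lambda * lt = (1 - q') * X + q' * (Q * c1 + Y).
    apply/eqP; rewrite -subr_eq0 /X; apply/eqP.
    transitivity ((x * (1 - q') - Q * (1 - q)) * (lt + c1)); first by rewrite lE; ring.
    by rewrite xE subrr mul0r.
  by apply: expR_mean2; rewrite ?subrK// ?subr_ge0 ltW.
have near c c' q q' : 0 < c -> 0 < c' -> 0 < q' -> lambda = Q * (2 - q - q') ->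
    t <= c `^ (- Q^-1) -> c' <= c ->
    expR (q * ln c + q' * ln c' - lambda * ln t) <= c * knear Q lambda t (c `^ (- Q^-1)).
  move=> c0 c'0 q'0 lE ct cc; rewrite knearE// lnr//.
  rewrite -{2}[c](lnK c0) -expRD ler_expR.
  have h : q' * ln c' <= q' * ln c by rewrite ler_wpM2l ?(ltW q'0)// ler_ln ?posrE.
  apply: (@le_trans _ _ (q * ln c + q' * ln c - lambda * ln t)).
    by rewrite lerD2r lerD2l.
  move: (lnQ c); set c1 := ln c / Q => ->; rewrite lE.
  by rewrite le_eqVlt; apply/orP; left; apply/eqP; ring.
have swap : p1 * ln a + p2 * ln b = p2 * ln b + p1 * ln a by rewrite addrC.
have f1 := far a b p1 p2 x1 a0 b0 p10 p11 p20 p21 x1E lamE.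
have f2 := far b a p2 p1 x2 b0 a0 p20 p21 p10 p11 x2E lamE'.
have n1 := near a b p1 p2 a0 b0 p20 lamE.
have n2 := near b a p2 p1 b0 a0 p10 lamE'.
clear far near ka kn; rewrite -swap [b * a]mulrC in f2 n2.
move: (a * kfar _ _ _ _) (b * kfar _ _ _ _) (a * knear _ _ _ _) (b * knear _ _ _ _)
  ka1 ka2 kn1 kn2 (a * b) ab f1 f2 n1 n2 => v1 v2 v3 v4 v10 v20 v30 v40 v5 v50.
move: (expR _) => w f1 f2 n1 n2.
have [ta|/ltW ta] := leP (a `^ (- Q^-1)) t; first by have := f1 ta; lra.
have [tb|/ltW tb] := leP (b `^ (- Q^-1)) t; first by have := f2 tb; lra.
have [ba|/ltW ba] := leP b a; first by have := n1 ta ba; lra.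
by have := n2 tb ba; lra.
Qed.

End PointwiseBounds.

(** * The nonnegative inequality from volume bounds and quasi-triangle inequalities *)

Section AbstractSteinWeiss.
Context {R : realType} {d : measure_display} {T : measurableType d}.
Variable mu : {sigma_finite_measure set T -> \bar R}.

Lemma upper_regular_null (A Q : R) (f : T -> R) : 0 <= A -> 0 < Q ->
  measurable_fun [set: T] f -> upper_regular mu A Q f ->
  mu [set x | f x <= 0] = 0%E.
Proof.
move=> A0 Q0 mf regf; apply/eqP; rewrite eq_le measure_ge0 andbT.
apply/lee_addgt0Pr => e e0; rewrite add0e.
have A1 : 0 < A + 1 by lra.
pose rho := (e / (A + 1)) `^ Q^-1.
have rho0 : 0 < rho by rewrite powR_gt0// divr_gt0.
apply: (@le_trans _ _ (mu [set x | f x <= rho])).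
  apply: le_measure; rewrite ?inE; try exact: measurable_sublevel.
  by move=> x /= /le_trans; apply; exact: ltW.
apply: le_trans (regf _ rho0) _.
rewrite lee_fin /rho -powRrM mulVf ?gt_eqF// powRr1 ?divr_ge0 ?(ltW e0) ?(ltW A1)//.
by rewrite mulrA ler_pdivrMr// mulrC ler_wpM2l ?(ltW e0)//; lra.
Qed.

Lemma measurable_sw_form (dd : measure_display) (S : measurableType dd)
    (p1 p2 alpha beta lambda : R) (a b n m t : S -> R) :
  measurable_fun [set: S] a -> measurable_fun [set: S] b ->
  measurable_fun [set: S] n -> measurable_fun [set: S] m ->
  measurable_fun [set: S] t ->
  measurable_fun [set: S] (fun x =>
    sw_form p1 p2 alpha beta lambda (a x) (b x) (n x) (m x) (t x)).
Proof.
move=> ma mb mn mm mt; rewrite /sw_form.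
under eq_fun do rewrite -powR_inv1 ?mulr_ge0 ?powR_ge0//.
apply: measurable_funM; first by apply: measurable_funM; exact: measurable_fun_powR.
apply: measurable_fun_powR; apply: measurable_funM; last exact: measurable_fun_powR.
by apply: measurable_funM; exact: measurable_fun_powR.
Qed.

Variables (A Q : R) (N : T -> R) (D : T * T -> R).
Hypotheses (A0 : 0 <= A).
Hypotheses (mN : measurable_fun [set: T] N) (N0 : forall u, 0 <= N u).
Hypotheses (mD : measurable_fun [set: T * T] D) (D0 : forall p, 0 <= D p).
Hypothesis regN : upper_regular mu A Q N.
Hypothesis regDl : forall u, upper_regular mu A Q (fun v => D (u, v)).
Hypothesis regDr : forall v, upper_regular mu A Q (fun u => D (u, v)).

Local Notation controlled := (controlled mu N D).

(** The pointwise bound is only asked for at positive arguments. The zeros of N form a null set by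
    the volume bound; at a zero of a, b or D the form is 0, for D because the inverse of 0 is 0. *)
Lemma controlled_dominates p1 p2 alpha beta lambda c (w : R -> R -> R -> R -> R -> R) :
  0 < Q -> 0 < p1 -> 0 < p2 -> 0 < lambda -> 0 <= c -> controlled w ->
  (forall a b u v, 0 < a -> 0 < b -> 0 < N u -> 0 < N v -> 0 < D (u, v) ->
    sw_form p1 p2 alpha beta lambda a b (N u) (N v) (D (u, v)) <=
    c * w a b (N u) (N v) (D (u, v))) ->
  exists2 C : R, 0 <= C & forall a b, unit_density mu a -> unit_density mu b ->
    (\int[mu \x mu]_p (sw_form p1 p2 alpha beta lambda (a p.1) (b p.2)
      (N p.1) (N p.2) (D p))%:E <= C%:E)%E.
Proof.
move=> Q0 p10 p20 l0 c0 [mw w0 [C C0 hC]] sww; exists (c * C); first exact: mulr_ge0.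
move=> a b ha hb; have [ma a0 _] := ha; have [mb b0 _] := hb.
have mww := mw a b ma mb.
apply: (@le_trans _ _
    (\int[mu \x mu]_p (c%:E * (w (a p.1) (b p.2) (N p.1) (N p.2) (D p))%:E))%E); last first.
  rewrite ge0_integralZl_EFin//.
  - by rewrite EFinM lee_wpmul2l ?lee_fin//; exact: hC.
  - by move=> p _; rewrite lee_fin w0.
  - exact/measurable_EFinP.
apply: ae_ge0_le_integral => //.
- by move=> p _; rewrite lee_fin sw_form_ge0.
- apply/measurable_EFinP; apply: measurable_sw_form => //.
  + exact: measurable_fst_comp.
  + exact: measurable_snd_comp.
  + exact: measurable_fst_comp.
  + exact: measurable_snd_comp.
- by move=> p _; rewrite mule_ge0// lee_fin// w0.
- by apply/measurable_EFinP; apply: measurable_funM.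
pose Z := [set x | N x <= 0].
have mZ : measurable Z by exact: measurable_sublevel.
have Z0 : mu Z = 0%E by exact: (upper_regular_null A0 Q0 mN regN).
have n1 : (mu \x mu)%E.-negligible (Z `*` [set: T]).
  apply/negligibleP; first exact: measurableX.
  have ZT : (mu Z * mu [set: T] = 0)%E by rewrite Z0 mul0e.
  exact: etrans (product_measure1E mu mu mZ measurableT) ZT.
have n2 : (mu \x mu)%E.-negligible ([set: T] `*` Z).
  apply/negligibleP; first exact: measurableX.
  have TZ : (mu [set: T] * mu Z = 0)%E by rewrite Z0 mule0.
  exact: etrans (product_measure1E mu mu measurableT mZ) TZ.
apply: negligibleS (negligibleU n1 n2) => -[u v] /= huv.
have [Nu|Nu] := leP (N u) 0; first by left.
have [Nv|Nv] := leP (N v) 0; first by right.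
exfalso; apply: huv => _; rewrite lee_fin.
have cw : 0 <= c * w (a u) (b v) (N u) (N v) (D (u, v)) by rewrite mulr_ge0// w0.
have [z|] := boolP [|| a u == 0, b v == 0 | D (u, v) == 0].
  by rewrite sw_form_eq0// -orbA.
rewrite !negb_or => /and3P[au bv Duv].
by apply: sww => //; rewrite lt_neqAle eq_sym ?au ?bv ?Duv ?a0 ?b0 ?D0.
Qed.

Lemma stein_weiss_regular p1 p2 alpha beta lambda K :
  admissible Q p1 p2 alpha beta lambda ->
  alpha < Q * (1 - p1) -> beta < Q * (1 - p2) -> 0 <= alpha + beta -> lambda < Q ->
  1 <= K -> (forall u v, quasi_triangle K (N u) (N v) (D (u, v))) ->
  exists2 C : R, 0 <= C & forall a b, unit_density mu a -> unit_density mu b ->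
    (\int[mu \x mu]_p (sw_form p1 p2 alpha beta lambda (a p.1) (b p.2)
      (N p.1) (N p.2) (D p))%:E <= C%:E)%E.
Proof.
move=> adm al be ab lQ K1 qt; have adm' := admissible_sym adm.
have [Q0 /andP[p10 p11] /andP[p20 p21] p12 l0 bal] := adm.
have s0 : 0 < 2 - p1 - p2 by lra.
(* The strict bounds on alpha and beta make [e1] and [e2] positive: Q + e is then integrable far out
   and Q - e near 0. *)
pose e1 := (Q * (1 - p1) - alpha) / (2 - p1 - p2).
pose e2 := (Q * (1 - p2) - beta) / (2 - p2 - p1).
have e1E : e1 * (2 - p1 - p2) = Q * (1 - p1) - alpha by rewrite divfK// gt_eqF.
have e2E : e2 * (2 - p2 - p1) = Q * (1 - p2) - beta by rewrite divfK// gt_eqF; lra.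
have e10 : 0 < e1 by rewrite divr_gt0//; lra.
have e20 : 0 < e2 by rewrite divr_gt0//; lra.
have e1Q : Q < Q + e1 by lra.
have e2Q : Q < Q + e2 by lra.
have e1Q' : Q - e1 < Q by lra.
have e2Q' : Q - e2 < Q by lra.
pose w1 := fun a b n m t : R => a * kfar Q (Q + e1) m n + b * knear Q (Q - e1) n m + a * b.
pose w2 := fun a b n m t : R => b * kfar Q (Q + e2) n m + a * knear Q (Q - e2) m n + a * b.
have cp : controlled (fun a b _ _ _ => a * b) by exact: controlled_prod.
have cw1 : controlled w1.
  apply: controlledD => //; apply: controlledD.
    exact: (controlled_left_far (X := fun m _ => m) (rho := fun _ n => n) A0 Q0
      mN N0 mD (fun m t hm ht => hm) (fun a n ha hn => hn) (fun a n _ n0 => n0)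
      e1Q (fun=> regN)).
  exact: (controlled_right_near (X := fun m _ => m) (rho := fun _ n => n) A0
    mN N0 mD D0 (fun m t hm ht => hm) (fun a n ha hn => hn) (fun m t m0 _ => m0)
    (fun a n _ n0 => n0) e1Q' (fun=> regN)).
have cw2 : controlled w2.
  apply: controlledD => //; apply: controlledD.
    exact: (controlled_right_far (X := fun m _ => m) (rho := fun _ n => n) A0 Q0
      mN N0 mD (fun m t hm ht => hm) (fun a n ha hn => hn) (fun a n _ n0 => n0)
      e2Q (fun=> regN)).
  exact: (controlled_left_near (X := fun m _ => m) (rho := fun _ n => n) A0
    mN N0 mD D0 (fun m t hm ht => hm) (fun a n ha hn => hn) (fun m t m0 _ => m0)
    (fun a n _ n0 => n0) e2Q' (fun=> regN)).
pose c1 := expR (lambda * ln (2 * K)).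
have c10 : 0 <= c1 by exact: expR_ge0.
have far_bound a b n m t : 0 < a -> 0 < b -> 0 < n -> 0 < m -> 0 < t ->
    quasi_triangle K n m t -> (2 * K * n <= m) || (2 * K * m <= n) ->
    sw_form p1 p2 alpha beta lambda a b n m t <= c1 * (w1 a b n m t + w2 a b n m t).
  move=> a0 b0 n0 m0 t0 q; have w10 : 0 <= w1 a b n m t.
    by rewrite !addr_ge0 ?mulr_ge0 ?kfar_ge0 ?knear_ge0 ?ltW.
  have w20 : 0 <= w2 a b n m t.
    by rewrite !addr_ge0 ?mulr_ge0 ?kfar_ge0 ?knear_ge0 ?ltW.
  case/orP=> h.
    apply: (le_trans (sw_form_hardy adm K1 a0 b0 n0 m0 t0 q h e1E)).
    by apply: ler_wpM2l => //; rewrite -[leLHS]addr0; exact: lerD.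
  rewrite -sw_form_sym.
  apply: (le_trans (sw_form_hardy adm' K1 b0 a0 m0 n0 t0 (quasi_triangle_sym q) h e2E)).
  rewrite [b * a]mulrC -/(w2 a b n m t).
  by apply: ler_wpM2l => //; rewrite -[leLHS]add0r; exact: lerD.
have combine (w3 : R -> R -> R -> R -> R -> R) c3 : 0 <= c3 -> controlled w3 ->
    (forall a b n m t, 0 < a -> 0 < b -> 0 < n -> 0 < m -> 0 < t ->
      quasi_triangle K n m t -> m <= 2 * K * n -> n <= 2 * K * m ->
      sw_form p1 p2 alpha beta lambda a b n m t <= c3 * w3 a b n m t) ->
    exists2 C : R, 0 <= C & forall a b, unit_density mu a -> unit_density mu b ->
    (\int[mu \x mu]_p (sw_form p1 p2 alpha beta lambda (a p.1) (b p.2)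
      (N p.1) (N p.2) (D p))%:E <= C%:E)%E.
  move=> c30 cw3 h3.
  apply: (@controlled_dominates _ _ _ _ _ (c1 + c3)
    (fun a b n m t => (w1 a b n m t + w2 a b n m t) + w3 a b n m t)) => //.
  - exact: addr_ge0.
  - by apply: controlledD => //; exact: controlledD.
  move=> a b u v a0 b0 u0 v0 t0.
  have [_ p1' _] := cw1; have [_ p2' _] := cw2; have [_ p3' _] := cw3.
  have h12 := addr_ge0 (p1' a b (N u) (N v) (D (u, v)) (ltW a0) (ltW b0))
    (p2' a b (N u) (N v) (D (u, v)) (ltW a0) (ltW b0)).
  have h33 := p3' a b (N u) (N v) (D (u, v)) (ltW a0) (ltW b0).
  have hq := qt u v.
  have [hf|] := boolP ((2 * K * N u <= N v) || (2 * K * N v <= N u)).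
    apply: (le_trans (far_bound _ _ _ _ _ a0 b0 u0 v0 t0 hq hf)).
    apply: ler_pM => //; first by rewrite lerDl.
    by rewrite lerDl.
  rewrite negb_or -!ltNge => /andP[/ltW h1 /ltW h2].
  apply: (le_trans (h3 _ _ _ _ _ a0 b0 u0 v0 t0 hq h1 h2)).
  apply: ler_pM => //; first by rewrite lerDr.
  by rewrite lerDr.
have [ab0|ab0] := eqVneq (alpha + beta) 0.
  pose x1 := Q * (1 - p1) / (1 - p2); pose x2 := Q * (1 - p2) / (1 - p1).
  have x1E : x1 * (1 - p2) = Q * (1 - p1) by rewrite divfK// gt_eqF// subr_gt0.
  have x2E : x2 * (1 - p1) = Q * (1 - p2) by rewrite divfK// gt_eqF// subr_gt0.
  have x10 : Q < Q + x1 by rewrite ltrDl divr_gt0 ?mulr_gt0 ?subr_gt0.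
  have x20 : Q < Q + x2 by rewrite ltrDl divr_gt0 ?mulr_gt0 ?subr_gt0.
  pose rho := fun a (_ : R) => a `^ (- Q^-1).
  have mrho (a n : T * T -> R) : measurable_fun [set: T * T] a ->
      measurable_fun [set: T * T] n -> measurable_fun [set: T * T] (fun p => rho (a p) (n p)).
    by move=> ma _; exact: measurable_fun_powR.
  have rho0 a n : 0 <= a -> 0 <= n -> 0 <= rho a n by move=> _ _; exact: powR_ge0.
  apply: (combine _ (expR (`|alpha| * ln (2 * K))) (expR_ge0 _)); last first.
    move=> a b n m t a0 b0 n0 m0 t0 _ h1 h2.
    exact: (sw_form_hls adm K1 ab0 a0 b0 n0 m0 t0 h1 h2 x1E x2E).
  apply: controlledD => //; apply: controlledD; apply: controlledD.
  - exact: (controlled_left_far (X := fun _ t => t) (rho := rho) A0 Q0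
      mN N0 mD (fun m t hm ht => ht) mrho rho0 x10 regDl).
  - exact: (controlled_left_near (X := fun _ t => t) (rho := rho) A0
      mN N0 mD D0 (fun m t hm ht => ht) mrho (fun m t _ t0 => t0) rho0 lQ regDl).
  - exact: (controlled_right_far (X := fun _ t => t) (rho := rho) A0 Q0
      mN N0 mD (fun m t hm ht => ht) mrho rho0 x20 regDr).
  - exact: (controlled_right_near (X := fun _ t => t) (rho := rho) A0
      mN N0 mD D0 (fun m t hm ht => ht) mrho (fun m t _ t0 => t0) rho0 lQ regDr).
have ab1 : 0 < alpha + beta by rewrite lt_neqAle eq_sym ab0.
pose gam := lambda / (2 - p1 - p2).
have gE : gam * (2 - p1 - p2) = lambda by rewrite divfK// gt_eqF.
(* By the balance equation, alpha + beta > 0 says lambda < Q (2 - p1 - p2). *)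
have gQ : gam < Q by rewrite ltr_pdivrMr//; lra.
pose rho := fun _ n : R => K * (1 + 2 * K) * n.
have mrho (a n : T * T -> R) : measurable_fun [set: T * T] a ->
    measurable_fun [set: T * T] n -> measurable_fun [set: T * T] (fun p => rho (a p) (n p)).
  by move=> _ mn; exact: measurable_funM.
have rho0 a n : 0 <= a -> 0 <= n -> 0 <= rho a n.
  by move=> _ n0; rewrite !mulr_ge0//; lra.
apply: (combine _ _ (expR_ge0 _)); last first.
  move=> a b n m t a0 b0 n0 m0 t0 q h1 h2.
  exact: (sw_form_comparable adm K1 a0 b0 n0 m0 t0 q h1 h2 gE).
apply: controlledD => //; apply: controlledD.
- exact: (controlled_left_near (X := fun _ t => t) (rho := rho) A0
    mN N0 mD D0 (fun m t hm ht => ht) mrho (fun m t _ t0 => t0) rho0 gQ regDl).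
- exact: (controlled_right_near (X := fun _ t => t) (rho := rho) A0
    mN N0 mD D0 (fun m t hm ht => ht) mrho (fun m t _ t0 => t0) rho0 gQ regDr).
Qed.

End AbstractSteinWeiss.

(** * Complex-valued functions *)

Section ComplexFunctions.
Context {R : realType} {d : measure_display} {T : measurableType d}.
Local Notation normc := Normc.normc.

Lemma normc_ge0 (z : R[i]) : 0 <= normc z.
Proof. by case: z => a b; exact: sqrtr_ge0. Qed.

Lemma normc_Re_le (z : R[i]) : `|complex.Re z| <= normc z.
Proof.
by case: z => a b /=; rewrite -sqrtr_sqr ler_wsqrtr// lerDl sqr_ge0.
Qed.

Lemma normc_Im_le (z : R[i]) : `|complex.Im z| <= normc z.
Proof.
by case: z => a b /=; rewrite -sqrtr_sqr ler_wsqrtr// lerDr sqr_ge0.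
Qed.

Lemma normc_le (a b : R) : normc (Complex a b) <= `|a| + `|b|.
Proof.
rewrite /= -[leRHS]ger0_norm ?addr_ge0// -sqrtr_sqr ler_wsqrtr//.
rewrite sqrrD !real_normK ?num_real// -addrA lerD2l lerDr.
by rewrite mulrn_wge0// mulr_ge0.
Qed.

Lemma measurable_normc (f : T -> R[i]) : cmeasurable f ->
  measurable_fun [set: T] (fun x => normc (f x)).
Proof.
move=> [mr mi].
have -> : (fun x => normc (f x)) =
    (fun x => Num.sqrt (complex.Re (f x) ^+ 2 + complex.Im (f x) ^+ 2)).
  by apply/funext => x; case: (f x).
apply: (@measurableT_comp _ _ _ _ _ _ (@Num.sqrt R)).
  by apply: continuous_measurable_fun; exact: sqrt_continuous.
by apply: measurable_funD; exact: measurable_funX.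
Qed.

(** X is any positive bound of the norm, so a function of norm 0 needs no separate treatment. *)
Lemma cLp_unit_density (mu : {sigma_finite_measure set T -> \bar R}) r (X : R)
    (f : T -> R[i]) : 0 < r -> 0 < X -> cLp mu r f -> (cLnorm mu r f <= X%:E)%E ->
  unit_density mu (fun x => (normc (f x) / X) `^ r).
Proof.
move=> r0 X0 [mf _] fX; have mn := measurable_normc mf.
have mnr : measurable_fun [set: T] (fun x => normc (f x) `^ r).
  exact: measurable_fun_powR.
split.
- by apply: measurable_fun_powR; exact: measurable_funM.
- by move=> x; exact: powR_ge0.
under eq_integral do rewrite powRM ?normc_ge0 ?invr_ge0 ?(ltW X0)// mulrC EFinM.
rewrite ge0_integralZl_EFin ?powR_ge0//; last 2 first.
- by move=> x _; rewrite lee_fin powR_ge0.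
- exact/measurable_EFinP.
have -> : (\int[mu]_x (normc (f x) `^ r)%:E = cLnorm mu r f `^ r)%E.
  rewrite [RHS]poweR_Lnorm; last by rewrite gt_eqF.
  apply: eq_integral => x _.
  by rewrite abse_EFin poweR_EFin ger0_norm ?normc_ge0.
have h : (cLnorm mu r f `^ r <= X%:E `^ r)%E.
  by apply: gt0_ler_poweR; rewrite ?in_itv/= ?leey ?andbT ?Lnorm_ge0 ?lee_fin ?(ltW X0) ?(ltW r0).
apply: (@le_trans _ _ ((X^-1 `^ r)%:E * (X%:E `^ r))%E).
  by rewrite lee_wpmul2l// lee_fin powR_ge0.
rewrite poweR_EFin -EFinM -powRM ?invr_ge0 ?(ltW X0)//.
by rewrite mulVf ?gt_eqF// powR1.
Qed.

(** The real and imaginary parts are bounded separately, whence the factor 2. *)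
Lemma cintegrable_bound (mu : {measure set T -> \bar R}) (F : T -> R[i]) (B : R) :
  cmeasurable F -> (\int[mu]_x (normc (F x))%:E <= B%:E)%E ->
  cintegrable mu F /\ normc (cintegral mu F) <= 2 * B.
Proof.
move=> mF FB; have mn := measurable_normc mF; have [mr mi] := mF.
have bnd (h : T -> R) : measurable_fun [set: T] h -> (forall x, `|h x| <= normc (F x)) ->
    mu.-integrable [set: T] (EFin \o h) /\ `|Rintegral mu [set: T] h| <= B.
  move=> mh hF.
  have hB : (\int[mu]_x `|(h x)%:E| <= B%:E)%E.
    apply: le_trans FB; apply: ge0_le_integral => //.
    - by apply/measurable_EFinP; exact: measurableT_comp.
    - exact/measurable_EFinP.
    - by move=> x _; rewrite abse_EFin lee_fin.
  have ih : mu.-integrable [set: T] (EFin \o h).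
    apply/integrableP; split; first exact/measurable_EFinP.
    by apply: le_lt_trans hB _; rewrite ltry.
  split => //; rewrite -lee_fin -abse_EFin /Rintegral fineK.
    apply: le_trans hB; apply: le_abse_integral => //.
    exact/measurable_EFinP.
  exact: integrable_fin_num.
have [ir br] := bnd _ mr (fun x => normc_Re_le (F x)).
have [ii bi] := bnd _ mi (fun x => normc_Im_le (F x)).
split; first by split.
apply: le_trans (normc_le _ _) _.
by have := lerD br bi; lra.
Qed.

End ComplexFunctions.

(** Removes the e that is added to each norm to make it positive before normalizing. *)
Lemma le_mul_perturb (R : realType) (I c x y : R) : 0 <= c -> 0 <= x -> 0 <= y ->
  (forall e, 0 < e -> I <= c * (x + e) * (y + e)) -> I <= c * x * y.
Proof.
move=> c0 x0 y0 h; apply/ler_addgt0Pr => e e0.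
pose K := c * (x + y + 1) + 1.
have K0 : 0 < K by rewrite ltr_wpDl// !mulr_ge0// !addr_ge0.
pose del := Num.min 1 (e / K).
have d0 : 0 < del by rewrite lt_min ltr01 divr_gt0.
have d1 : del <= 1 by rewrite ge_min lexx.
have dK : del * K <= e by rewrite -ler_pdivlMr// ge_min lexx orbT.
apply: le_trans (h _ d0) _.
have -> : c * (x + del) * (y + del) = c * x * y + del * (c * (x + y + del)) by ring.
rewrite lerD2l; apply: le_trans dK; rewrite ler_wpM2l ?(ltW d0)// /K.
by rewrite -[leLHS]addr0 lerD// ler_wpM2l// lerD2l.
Qed.

(** * From normalized densities to complex-valued functions *)

Section ComplexSteinWeiss.
Context {R : realType} {d : measure_display} {T : measurableType d}.
Variable mu : {sigma_finite_measure set T -> \bar R}.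
Variables (A Q K : R) (N : T -> R) (D : T * T -> R).
Hypotheses (A0 : 0 <= A) (K1 : 1 <= K).
Hypotheses (mN : measurable_fun [set: T] N) (N0 : forall u, 0 <= N u).
Hypotheses (mD : measurable_fun [set: T * T] D) (D0 : forall p, 0 <= D p).
Hypothesis regN : upper_regular mu A Q N.
Hypothesis regDl : forall u, upper_regular mu A Q (fun v => D (u, v)).
Hypothesis regDr : forall v, upper_regular mu A Q (fun u => D (u, v)).
Hypothesis qt : forall u v, quasi_triangle K (N u) (N v) (D (u, v)).
Local Notation normc := Normc.normc.

Lemma stein_weiss_complex (r s alpha beta lambda : R) : 1 < r -> 1 < s ->
  admissible Q r^-1 s^-1 alpha beta lambda ->
  alpha < Q * (1 - r^-1) -> beta < Q * (1 - s^-1) -> 0 <= alpha + beta -> lambda < Q ->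
  exists C : R, 0 < C /\ forall f g : T -> R[i], cLp mu r f -> cLp mu s g ->
    let F := fun p : T * T => (conjc (f p.1) * g p.2) /
      real_complex R (N p.1 `^ alpha * D p `^ lambda * N p.2 `^ beta) in
    cintegrable (mu \x mu)%E F /\
    ((normc (cintegral (mu \x mu)%E F))%:E <= C%:E * cLnorm mu r f * cLnorm mu s g)%E.
Proof.
move=> r1 s1 adm al be ab lQ.
have r0 : 0 < r by rewrite (lt_trans ltr01).
have s0 : 0 < s by rewrite (lt_trans ltr01).
have [C C0 hC] := stein_weiss_regular A0 mN N0 mD D0 regN regDl regDr adm al be ab lQ K1 qt.
(* The 2 is that of [cintegrable_bound]; C may be 0, and the 1 makes the constant positive. *)
exists (2 * C + 1); split; first by rewrite ltr_wpDl// mulr_ge0.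
move=> f g hf hg F.
have [[mfr mfi] foo] := hf; have [[mgr mgi] goo] := hg.
pose x := fine (cLnorm mu r f); pose y := fine (cLnorm mu s g).
have x0 : 0 <= x by rewrite fine_ge0// Lnorm_ge0.
have y0 : 0 <= y by rewrite fine_ge0// Lnorm_ge0.
have xE : cLnorm mu r f = x%:E by rewrite fineK// ge0_fin_numE// Lnorm_ge0.
have yE : cLnorm mu s g = y%:E by rewrite fineK// ge0_fin_numE// Lnorm_ge0.
pose kap (p : T * T) := (N p.1 `^ alpha * D p `^ lambda * N p.2 `^ beta)^-1.
have mkap : measurable_fun [set: T * T] kap.
  (* Zero exponents on the densities turn the form into the bare kernel, whose measurability is then
     an instance of [measurable_sw_form]. *)
  have -> : kap = (fun p => sw_form 0 0 alpha beta lambda 1 1 (N p.1) (N p.2) (D p)).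
    by apply/funext => p; rewrite /sw_form !powRr0 !mul1r.
  apply: measurable_sw_form => //.
    exact: measurable_fst_comp.
  exact: measurable_snd_comp.
have FE p : F p = Complex
    ((complex.Re (f p.1) * complex.Re (g p.2) + complex.Im (f p.1) * complex.Im (g p.2)) * kap p)
    ((complex.Re (f p.1) * complex.Im (g p.2) - complex.Im (f p.1) * complex.Re (g p.2)) * kap p).
  rewrite /F -(fmorphV (real_complex R)) -/(kap p).
  case: (f p.1) => a b; case: (g p.2) => c e.
  by apply/eqP; rewrite eq_complex /= !mulr0 subr0 add0r mulNr opprK mulNr !eqxx.
have mF : cmeasurable F.
  have fr1 := measurable_fst_comp mfr; have fi1 := measurable_fst_comp mfi.
  have gr2 := measurable_snd_comp mgr; have gi2 := measurable_snd_comp mgi.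
  split; under eq_fun do rewrite FE /=.
    exact: (measurable_funM (measurable_funD (measurable_funM fr1 gr2)
      (measurable_funM fi1 gi2)) mkap).
  exact: (measurable_funM (measurable_funB (measurable_funM fr1 gi2)
    (measurable_funM fi1 gr2)) mkap).
have kap0 p : 0 <= kap p by rewrite invr_ge0 !mulr_ge0 ?powR_ge0.
have nF p : normc (F p) = normc (f p.1) * normc (g p.2) * kap p.
  rewrite /F Normc.normcM Normc.normcV Normc.normcM; congr (_ * _ * _).
    by case: (f p.1) => a b /=; rewrite sqrrN.
  rewrite /= expr0n addr0 sqrtr_sqr ger0_norm//.
  by rewrite !mulr_ge0 ?powR_ge0.
have main e : 0 < e ->
    (\int[mu \x mu]_p (normc (F p))%:E <= (C * (x + e) * (y + e))%:E)%E.
  move=> e0; have X0 : 0 < x + e by rewrite ltr_wpDl.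
  have Y0 : 0 < y + e by rewrite ltr_wpDl.
  have uf : unit_density mu (fun u => (normc (f u) / (x + e)) `^ r).
    by apply: cLp_unit_density => //; rewrite xE lee_fin lerDl ltW.
  have ug : unit_density mu (fun u => (normc (g u) / (y + e)) `^ s).
    by apply: cLp_unit_density => //; rewrite yE lee_fin lerDl ltW.
  have root (q z : R) : 0 < q -> 0 <= z -> (z `^ q) `^ q^-1 = z.
    by move=> q0 z0; rewrite -powRrM mulfV ?gt_eqF// powRr1.
  pose w (p : T * T) := sw_form r^-1 s^-1 alpha beta lambda
    ((normc (f p.1) / (x + e)) `^ r) ((normc (g p.2) / (y + e)) `^ s)
    (N p.1) (N p.2) (D p).
  have hw : (\int[mu \x mu]_p (w p)%:E <= C%:E)%E := hC _ _ uf ug.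
  have Fw p : normc (F p) = (x + e) * (y + e) * w p.
    rewrite nF /w /sw_form !root ?divr_ge0 ?normc_ge0 ?(ltW X0) ?(ltW Y0)//.
    rewrite -/(kap p) mulrA; congr (_ * _).
    rewrite mulrACA [(x + e) * _]mulrC [(y + e) * _]mulrC.
    by rewrite !divfK// gt_eqF.
  under eq_integral do rewrite Fw EFinM.
  rewrite ge0_integralZl_EFin//.
  - rewrite -mulrA [C * _]mulrC [in leRHS]EFinM lee_wpmul2l// lee_fin mulr_ge0 ?ltW//.
  - by move=> p _; rewrite lee_fin sw_form_ge0.
  - have [muf _ _] := uf; have [mug _ _] := ug.
    apply/measurable_EFinP; apply: measurable_sw_form => //.
    + exact: (measurable_fst_comp muf).
    + exact: (measurable_snd_comp mug).
    + exact: measurable_fst_comp.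
    + exact: measurable_snd_comp.
  - by rewrite mulr_ge0 ?ltW.
have I0 : (0 <= \int[mu \x mu]_p (normc (F p))%:E)%E.
  by apply: integral_ge0 => p _; rewrite lee_fin normc_ge0.
have IE : (\int[mu \x mu]_p (normc (F p))%:E)%E \is a fin_num.
  by rewrite ge0_fin_numE//; apply: le_lt_trans (main 1 ltr01) _; rewrite ltry.
have bound : (\int[mu \x mu]_p (normc (F p))%:E <= (C * x * y)%:E)%E.
  rewrite -[leLHS]fineK// lee_fin; apply: le_mul_perturb => // e e0.
  by rewrite -lee_fin fineK//; exact: main.
have [iF nI] := cintegrable_bound mF bound; split => //.
rewrite xE yE -!EFinM lee_fin; apply: le_trans nI _.
have -> : (2 * C + 1) * x * y = 2 * (C * x * y) + x * y by ring.
by rewrite lerDl mulr_ge0.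
Qed.

End ComplexSteinWeiss.

Theorem theorem2p1 (R : realType) (G : carnotGroup R)
  (mu : {sigma_finite_measure set (carnot G) -> \bar R}) (hmu : is_haar G mu)
  (r s r' s' lambda alpha beta : R)
  (hr : 1 < r) (hs : 1 < s)
  (hr' : r^-1 + r'^-1 = 1) (hs' : s^-1 + s'^-1 = 1)
  (hlambda0 : 0 < lambda) (hlambdaQ : lambda < (hdim G)%:R)
  (hab : 0 <= alpha + beta)
  (hlab : lambda + alpha + beta <= (hdim G)%:R)
  (halpha : alpha < (hdim G)%:R / r') (hbeta : beta < (hdim G)%:R / s')
  (hbal : r^-1 + s^-1 + (lambda + alpha + beta) / (hdim G)%:R = 2) :
  exists C : R, 0 < C /\
    forall f g : carnot G -> complex R, cLp mu r f -> cLp mu s g ->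
      let F := stein_weiss_integrand G alpha beta lambda f g in
      cintegrable (mu \x mu)%E F /\
      ((Normc.normc (cintegral (mu \x mu)%E F))%:E
         <= C%:E * cLnorm mu r f * cLnorm mu s g)%E.
Proof.
have Q0 : (0 < hdim G)%N by rewrite -(ltr0n R) (lt_trans hlambda0).
have k0 := hdim_step Q0.
have [A A0 hball] := haar_ball_le hmu Q0.
have [K K1 hK] := cdist_quasi_triangle k0.
have rQ rho : 0 < rho -> rho ^+ hdim G = rho `^ (hdim G)%:R.
  by move=> rho0; rewrite powR_mulrn// ltW.
have regN : upper_regular mu A (hdim G)%:R (hnorm G : carnot G -> R).
  by move=> rho rho0; rewrite -rQ//; have [h _] := hball rho rho0; exact: h.
pose D := fun p : carnot G * carnot G => cdist p.1 p.2.
have regDl u : upper_regular mu A (hdim G)%:R (fun v => D (u, v)).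
  by move=> rho rho0; rewrite -rQ//; have [_ h] := hball rho rho0; exact: h.
(* Left invariance controls D in its second variable only; symmetry gives the first. *)
have regDr v : upper_regular mu A (hdim G)%:R (fun u => D (u, v)).
  have -> : (fun u => D (u, v)) = (fun u => D (v, u)).
    by apply/funext => u; exact: cdistC.
  exact: regDl.
have qt (u v : carnot G) : quasi_triangle K (hnorm G u) (hnorm G v) (D (u, v)).
  exact: hK.
have Qpos : 0 < (hdim G)%:R :> R by rewrite ltr0n.
have hr'E : r'^-1 = 1 - r^-1 by rewrite -hr'; ring.
have hs'E : s'^-1 = 1 - s^-1 by rewrite -hs'; ring.
move: hlambdaQ hlab halpha hbeta hbal; rewrite hr'E hs'E.
have conj (q : R) : 1 < q -> 0 < q^-1 < 1.
  move=> q1; have q0 := lt_trans ltr01 q1.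
  by rewrite invr_gt0 q0 invf_lt1.
have r1 := conj r hr; have s1 := conj s hs.
move=> lQ lab al be bal.
have lE : lambda + alpha + beta = (hdim G)%:R * (2 - r^-1 - s^-1).
  have -> : 2 - r^-1 - s^-1 = (lambda + alpha + beta) / (hdim G)%:R.
    by rewrite -bal; ring.
  by rewrite mulrC divfK// gt_eqF.
have adm : admissible (hdim G)%:R r^-1 s^-1 alpha beta lambda.
  split => //; rewrite lE -[leRHS]mulr1 ler_pM2l// in lab.
  by rewrite -subr_ge0 -(opprK (_ - 1)) oppr_ge0; lra.
have mN : measurable_fun [set: carnot G] (hnorm G : carnot G -> R).
  exact: measurable_hnorm_id.
have mD := @measurable_cdist R G k0.
have [C [C0 hC]] := stein_weiss_complex A0 K1 mN (@hnorm_ge0 R G)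
  mD (fun p => cdist_ge0 p.1 p.2) regN regDl regDr qt
  hr hs adm al be hab lQ.
exists C; split; first exact: C0.
by move=> f g hf hg; exact: hC.
Qed.
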